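(* The theory $\mathsf{BIM}$ proves: $$\mathbf{FT}\leftrightarrow \mathbf{\Sigma}^0_1\text{-}\overleftarrow{\mathbf{AC}_{\omega,2}}\qquad\text{and}\qquad \neg!\mathbf{FT}\leftrightarrow \neg!(\mathbf{\Sigma}^0_1\text{-}\overleftarrow{\mathbf{AC}_{\omega,2}}).$$ Here $\mathbf{FT}$ is $\forall \alpha[Bar_{2^\omega}(D_\alpha)\rightarrow\exists m[Bar_{2^\omega}(D_{\overline\alpha m})]]$; $\neg!\mathbf{FT}$ is $\exists\alpha[Bar_{2^\omega}(D_\alpha)\wedge\forall m[\neg Bar_{2^\omega}(D_{\overline\alpha m})]]$; $\mathbf{\Sigma}^0_1\text{-}\overleftarrow{\mathbf{AC}_{\omega,2}}$ is $\forall\alpha[\forall\gamma\in2^\omega\exists n[(n,\gamma(n))\in E_\alpha]\rightarrow\exists n\forall i<2[(n,i)\in E_\alpha]]$; and $\neg!(\mathbf{\Sigma}^0_1\text{-}\overleftarrow{\mathbf{AC}_{\omega,2}})$ is $\exists\alpha[\forall\gamma\in2^\omega\exists n[(n,\gamma(n))\in E_\alpha]\wedge\neg\exists n\forall i<2[(n,i)\in E_\alpha]]$.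
   Context: $\mathsf{BIM}$ (Basic Intuitionistic Mathematics) is the following two-sorted first-order theory with intuitionistic logic and equality. Numerical variables $m,n,p,\ldots$ range over $\omega=\{0,1,2,\ldots\}$; function variables $\alpha,\beta,\gamma,\ldots$ range over the set $\omega^\omega$ of infinite sequences of natural numbers. There are a numerical constant $0$, unary function constants $Id,\underline 0,S,K,L$ and a binary function symbol $J$; numerical terms are built from numerical variables and $0$ by applying function symbols and function variables. Axioms: (1) $\forall\alpha\forall\beta[\alpha=\beta\leftrightarrow\forall n[\alpha(n)=\beta(n)]]$; (2) $Id(n)=n$, $S(n)\neq 0$, $S(m)=S(n)\rightarrow m=n$, $\underline 0(n)=0$, $K(J(m,n))=m$, $L(J(m,n))=n$, $J(K(n),L(n))=n$; (3) $\forall\alpha\forall\beta\exists\gamma\forall n[\gamma(n)=\alpha(\beta(n))]$, $\forall\alpha\forall\beta\exists\gamma\forall n[\gamma(n)=J(\alpha(n),\beta(n))]$, $\forall\alpha\forall\beta\exists\gamma\forall m\forall n[\gamma(m,0)=\alpha(m)\wedge\gamma(m,S(n))=\beta(m,n,\gamma(m,n))]$, $\forall\alpha[\forall n\exists m[\alpha(n,m)=0]\rightarrow\exists\gamma\forall n[\alpha(n,\gamma(n))=0]]$; (4) induction for all formulas of the language. Here $(m,n):=J(m,n)$, $\alpha(m,n):=\alpha(J(m,n))$, $\alpha(m,n,p):=\alpha(J(J(m,n),p))$, $n':=K(n)$, $n'':=L(n)$. $\mathsf{BIM}$ is tacitly extended (conservatively) by symbols and defining equations for all primitive recursive functions and relations.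 Subsets of $\omega$ and $\omega^\omega$ are given by formulas; set notation is an abbreviation. Finite sequences are coded by natural numbers: $\langle\,\rangle=0$, $\langle m_0,\ldots,m_{k-1}\rangle=p(k-1)\cdot\prod_{i<k}p(i)^{m_i}-1$ for $k>0$ ($p(0)=2,p(1)=3,\ldots$ the primes); every number codes exactly one finite sequence. $length(s)$ is the length of the sequence coded by $s$ and $s(i)$ its $i$-th entry ($s(i)=0$ if $i\ge length(s)$). $\overline\alpha n=\langle\alpha(0),\ldots,\alpha(n-1)\rangle$. $2^\omega=\{\gamma\mid\forall n[\gamma(n)<2]\}$. $D_\alpha=\{i\mid\alpha(i)\neq0\}$; for a number $a$, $D_a=\{i<length(a)\mid a(i)\neq0\}$. $E_\alpha=\{n\mid\exists p[\alpha(p)=n+1]\}$. For $\mathcal X\subseteq\omega^\omega$, $B\subseteq\omega$: $Bar_{\mathcal X}(B)$ means $\forall\gamma\in\mathcal X\exists n[\overline\gamma n\in B]$. *)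

(* Defs.v *)
From Stdlib Require Import List.

(** * The language of BIM

    [pr] is the type of function constants: the constants of BIM together with
    one constant for every primitive recursive definition.  As everywhere in BIM,
    a function of several arguments is a unary function applied to [J]-tuples:
    [f(m,n) := f(J(m,n))], [f(m,n,p) := f(J(J(m,n),p))].  The defining equations
    of [PComp], [PPair] and [PRec] are in [BIM_axiom]; they mirror the closure
    axioms of BIM. *)

Inductive pr : Type :=
| PId | PZero | PSucc | PK | PL
| PComp (f g : pr)
| PPair (f g : pr)
| PRec (f g : pr).

(** Numerical and function variables are de Bruijn indices, in two separate
    index spaces: a numerical quantifier binds numerical index 0 and leaves the
    function indices alone, and vice versa. *)

Inductive fterm : Type :=
| FVar (i : nat)
| FConst (f : pr).

Inductive nterm : Type :=
| NVar (i : nat)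
| NZero
| NApp (a : fterm) (t : nterm)
| NJ (s t : nterm).

Inductive form : Type :=
| EqN (s t : nterm)
| EqF (a b : fterm)
| Bot
| Imp (A B : form)
| And (A B : form)
| Or (A B : form)
| AllN (A : form)
| ExN (A : form)
| AllF (A : form)
| ExF (A : form).

Definition Neg (A : form) : form := Imp A Bot.
Definition Iff (A B : form) : form := And (Imp A B) (Imp B A).

Declare Scope bim_scope.
Delimit Scope bim_scope with bim.
Bind Scope bim_scope with nterm fterm form.
Open Scope bim_scope.

Notation "# i" := (NVar i) (at level 2, i at level 1, format "# i") : bim_scope.
Notation "$ i" := (FVar i) (at level 2, i at level 1, format "$ i") : bim_scope.
Notation "a @ t" := (NApp a t) (at level 40, left associativity) : bim_scope.
Notation "⟨ s , t ⟩" := (NJ s t) (at level 0, format "⟨ s ,  t ⟩") : bim_scope.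
Notation "s == t" := (EqN s t) (at level 70, no associativity) : bim_scope.
Notation "A ⇒ B" := (Imp A B) (at level 99, B at level 200, right associativity) : bim_scope.
Notation "A ∧ B" := (And A B) (at level 80, right associativity) : bim_scope.
Notation "¬ A" := (Neg A) (at level 75, right associativity) : bim_scope.

Coercion FConst : pr >-> fterm.

Definition Succ (t : nterm) : nterm := PSucc @ t.

(** ** Simultaneous substitution *)

Definition scons {X : Type} (x : X) (s : nat -> X) (i : nat) : X :=
  match i with O => x | S j => s j end.

Definition fsubst (sf : nat -> fterm) (a : fterm) : fterm :=
  match a with FVar i => sf i | FConst f => FConst f end.

Fixpoint nsubst (sn : nat -> nterm) (sf : nat -> fterm) (t : nterm) : nterm :=
  match t with
  | NVar i => sn i
  | NZero => NZero
  | NApp a u => NApp (fsubst sf a) (nsubst sn sf u)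
  | NJ u v => NJ (nsubst sn sf u) (nsubst sn sf v)
  end.

(** [nup] weakens by one numerical variable, [fup] and [nup_f] by one function
    variable. *)
Definition nup (t : nterm) : nterm := nsubst (fun i => #(S i)) FVar t.
Definition fup (a : fterm) : fterm := fsubst (fun i => $(S i)) a.
Definition nup_f (t : nterm) : nterm := nsubst NVar (fun i => $(S i)) t.

Fixpoint subst (sn : nat -> nterm) (sf : nat -> fterm) (A : form) : form :=
  match A with
  | EqN s t => EqN (nsubst sn sf s) (nsubst sn sf t)
  | EqF a b => EqF (fsubst sf a) (fsubst sf b)
  | Bot => Bot
  | Imp A B => Imp (subst sn sf A) (subst sn sf B)
  | And A B => And (subst sn sf A) (subst sn sf B)
  | Or A B => Or (subst sn sf A) (subst sn sf B)
  | AllN A => AllN (subst (scons #0 (fun i => nup (sn i))) sf A)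
  | ExN A => ExN (subst (scons #0 (fun i => nup (sn i))) sf A)
  | AllF A => AllF (subst (fun i => nup_f (sn i)) (scons $0 (fun i => fup (sf i))) A)
  | ExF A => ExF (subst (fun i => nup_f (sn i)) (scons $0 (fun i => fup (sf i))) A)
  end.

Definition weakN (A : form) : form := subst (fun i => #(S i)) FVar A.
Definition weakF (A : form) : form := subst NVar (fun i => $(S i)) A.
Definition instN (A : form) (t : nterm) : form := subst (scons t NVar) FVar A.
Definition instF (A : form) (a : fterm) : form := subst NVar (scons a FVar) A.

(** * The axioms of BIM

    The induction axiom may have parameters; it stands for its universal
    closure. *)

Inductive BIM_axiom : form -> Prop :=
| ax_ext :
    BIM_axiom (AllF (AllF (Iff (EqF $1 $0) (AllN ($1 @ #0 == $0 @ #0)))))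
| ax_Id : BIM_axiom (AllN (PId @ #0 == #0))
| ax_S_neq_0 : BIM_axiom (AllN (¬ (Succ #0 == NZero)))
| ax_S_inj : BIM_axiom (AllN (AllN (Succ #1 == Succ #0 ⇒ #1 == #0)))
| ax_Zero : BIM_axiom (AllN (PZero @ #0 == NZero))
| ax_KJ : BIM_axiom (AllN (AllN (PK @ ⟨#1, #0⟩ == #1)))
| ax_LJ : BIM_axiom (AllN (AllN (PL @ ⟨#1, #0⟩ == #0)))
| ax_JKL : BIM_axiom (AllN (⟨PK @ #0, PL @ #0⟩ == #0))
| ax_comp :
    BIM_axiom (AllF (AllF (ExF (AllN ($0 @ #0 == $2 @ ($1 @ #0))))))
| ax_pair :
    BIM_axiom (AllF (AllF (ExF (AllN ($0 @ #0 == ⟨$2 @ #0, $1 @ #0⟩)))))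
| ax_rec :
    BIM_axiom (AllF (AllF (ExF (AllN (AllN (
      $0 @ ⟨#1, NZero⟩ == $2 @ #1
      ∧ $0 @ ⟨#1, Succ #0⟩ == $1 @ ⟨⟨#1, #0⟩, $0 @ ⟨#1, #0⟩⟩))))))
| ax_choice :
    BIM_axiom (AllF (AllN (ExN ($0 @ ⟨#1, #0⟩ == NZero))
                     ⇒ ExF (AllN ($1 @ ⟨#0, $0 @ #0⟩ == NZero))))
| ax_ind (A : form) :
    BIM_axiom (instN A NZero
               ⇒ AllN (A ⇒ subst (scons (Succ #0) (fun i => #(S i))) FVar A)
               ⇒ AllN A)
(* defining equations of the primitive recursive function constants *)
| ax_PComp (f g : pr) : BIM_axiom (AllN (PComp f g @ #0 == f @ (g @ #0)))
| ax_PPair (f g : pr) : BIM_axiom (AllN (PPair f g @ #0 == ⟨f @ #0, g @ #0⟩))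
| ax_PRec_0 (f g : pr) :
    BIM_axiom (AllN (PRec f g @ ⟨#0, NZero⟩ == f @ #0))
| ax_PRec_S (f g : pr) :
    BIM_axiom (AllN (AllN (PRec f g @ ⟨#1, Succ #0⟩
                           == g @ ⟨⟨#1, #0⟩, PRec f g @ ⟨#1, #0⟩⟩))).

(** * Intuitionistic natural deduction with equality, over the axioms of BIM *)

Inductive prv : list form -> form -> Prop :=
| prv_ax G A : BIM_axiom A -> prv G A
| prv_hyp G A : In A G -> prv G A
| prv_botE G A : prv G Bot -> prv G A
| prv_impI G A B : prv (A :: G) B -> prv G (Imp A B)
| prv_impE G A B : prv G (Imp A B) -> prv G A -> prv G B
| prv_andI G A B : prv G A -> prv G B -> prv G (And A B)
| prv_andE1 G A B : prv G (And A B) -> prv G A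
| prv_andE2 G A B : prv G (And A B) -> prv G B
| prv_orI1 G A B : prv G A -> prv G (Or A B)
| prv_orI2 G A B : prv G B -> prv G (Or A B)
| prv_orE G A B C :
    prv G (Or A B) -> prv (A :: G) C -> prv (B :: G) C -> prv G C
| prv_allNI G A : prv (map weakN G) A -> prv G (AllN A)
| prv_allNE G A t : prv G (AllN A) -> prv G (instN A t)
| prv_exNI G A t : prv G (instN A t) -> prv G (ExN A)
| prv_exNE G A C : prv G (ExN A) -> prv (A :: map weakN G) (weakN C) -> prv G C
| prv_allFI G A : prv (map weakF G) A -> prv G (AllF A)
| prv_allFE G A a : prv G (AllF A) -> prv G (instF A a)
| prv_exFI G A a : prv G (instF A a) -> prv G (ExF A)
| prv_exFE G A C : prv G (ExF A) -> prv (A :: map weakF G) (weakF C) -> prv G C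
| prv_eqN_refl G t : prv G (EqN t t)
| prv_eqN_elim G A s t : prv G (EqN s t) -> prv G (instN A s) -> prv G (instN A t)
| prv_eqF_refl G a : prv G (EqF a a)
| prv_eqF_elim G A a b : prv G (EqF a b) -> prv G (instF A a) -> prv G (instF A b).

Definition BIM_proves (A : form) : Prop := prv nil A.

(** * Primitive recursive functions

    In the second argument [g] of [PRec f g], which is applied to [((x,n),r)]
    with [r] the value at [(x,n)], the three components are [rx], [rn], [rr]. *)

Notation "f ∘ g" := (PComp f g) (at level 40, left associativity) : bim_scope.
Notation "⟪ f , g ⟫" := (PPair f g) (at level 0) : bim_scope.
Bind Scope bim_scope with pr.

Definition rx : pr := PK ∘ PK.
Definition rn : pr := PL ∘ PK.
Definition rr : pr := PL.

Definition pone : pr := PSucc ∘ PZero.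
Definition ptwo : pr := PSucc ∘ pone.

(** [pnatrec c g] has value [c] at [0] and [g(((0,n),r))] at [n+1]. *)
Definition pnatrec (c g : pr) : pr := PRec c g ∘ ⟪PZero, PId⟫.

Definition padd : pr := PRec PId (PSucc ∘ rr).
Definition pmul : pr := PRec PZero (padd ∘ ⟪rr, rx⟫).
Definition ppow : pr := PRec pone (pmul ∘ ⟪rr, rx⟫).
Definition pfact : pr := pnatrec pone (pmul ∘ ⟪PSucc ∘ rn, rr⟫).
Definition ppred : pr := pnatrec PZero rn.
(* truncated subtraction *)
Definition psub : pr := PRec PId (ppred ∘ rr).
Definition pdist : pr := padd ∘ ⟪psub, psub ∘ ⟪PL, PK⟫⟫.

(** Relations used as tests hold when the value is 0. *)

Definition pite (c a b : pr) : pr := PRec PK (PL ∘ rx) ∘ ⟪⟪a, b⟫, c⟫.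
Definition pnot (f : pr) : pr := psub ∘ ⟪pone, f⟫.

(** [pmu f (x,n)] is the least [i < n] such that [f(x,i) = 0], and [n] if there
    is no such [i]. *)
Definition pmu (f : pr) : pr :=
  PRec PZero (pite (f ∘ ⟪rx, rr⟫) rr (PSucc ∘ rr)).

(** [pdvd (d,n) = 0] iff [d] divides [n]: some [q <= n] satisfies [d * q = n]. *)
Definition pdvd : pr :=
  psub ∘ ⟪pmu (pdist ∘ ⟪pmul ∘ ⟪PK ∘ PK, PL⟫, PL ∘ PK⟫) ∘ ⟪PId, PSucc ∘ PL⟫, PL⟫.

(** [pprime q = 0] iff [q] is prime: [2 <= q], and the least divisor [i >= 2]
    of [q] is not below [q]. *)
Definition pprime : pr :=
  padd ∘ ⟪psub ∘ ⟪ptwo, PId⟫,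
          psub ∘ ⟪PId,
                  pmu (padd ∘ ⟪psub ∘ ⟪ptwo, PL⟫, pdvd ∘ ⟪PL, PK⟫⟫) ∘ ⟪PId, PId⟫⟫⟫.

(** The least prime above [x]; it is at most [x! + 1]. *)
Definition pnextprime : pr :=
  pmu (padd ∘ ⟪psub ∘ ⟪PSucc ∘ PK, PL⟫, pprime ∘ PL⟫)
  ∘ ⟪PId, PSucc ∘ PSucc ∘ pfact⟫.

(** [p(0) = 2, p(1) = 3, p(2) = 5, ...] *)
Definition pnthprime : pr := pnatrec ptwo (pnextprime ∘ rr).

(** [pval (q,n)] is the exponent of the prime [q] in [n > 0]: the least [e]
    such that [q ^ (e+1)] does not divide [n]. *)
Definition pval : pr :=
  pmu (pnot (pdvd ∘ ⟪ppow ∘ ⟪PK ∘ PK, PSucc ∘ PL⟫, PL ∘ PK⟫)) ∘ ⟪PId, PL⟫.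

(** Coding of finite sequences:
    [s + 1 = p(k-1) * prod_{i<k} p(i)^{m_i}] codes [m_0, ..., m_{k-1}] for
    [k > 0], and [0] codes the empty sequence.  Hence the length of [s] is
    [j + 1] for the largest [j] such that [p(j)] divides [s + 1], or [0] if
    there is none, and the entry at [i] is the exponent of [p(i)] in [s + 1],
    diminished by 1 if [i + 1] is the length. *)
Definition plength : pr :=
  PRec PZero (pite (pdvd ∘ ⟪pnthprime ∘ rn, PSucc ∘ rx⟫) (PSucc ∘ rn) rr)
  ∘ ⟪PId, PSucc⟫.

(* [pentry (s,i)] is [s(i)] *)
Definition pentry : pr :=
  psub ∘ ⟪pval ∘ ⟪pnthprime ∘ PL, PSucc ∘ PK⟫,
          pnot (pdist ∘ ⟪PSucc ∘ PL, plength ∘ PK⟫)⟫.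

(** * The formulas *)

Definition Lt (s t : nterm) : form := psub @ ⟨Succ s, t⟩ == NZero.
Definition Length (s : nterm) : nterm := plength @ s.
Definition Entry (s i : nterm) : nterm := pentry @ ⟨s, i⟩.
Definition Two : nterm := Succ (Succ NZero).

(** [s] codes the sequence [a(0), ..., a(n-1)], i.e. [s] is the initial part of
    [a] of length [n].  Every number codes exactly one finite sequence, so
    "the initial part of [a] of length [n] satisfies A" is expressed as
    [ExN (InitSeg #0 a n ∧ A)], with [n] and [A] duly weakened. *)
Definition InitSeg (s : nterm) (a : fterm) (n : nterm) : form :=
  Length s == n ∧ AllN (Lt #0 (nup n) ⇒ Entry (nup s) #0 == a @ #0).

Definition InCantor (a : fterm) : form := AllN (Lt (a @ #0) Two).

(** Membership of [t] in D_a, for a function [a] and for a number [a]. *)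
Definition InDf (a : fterm) (t : nterm) : form := ¬ (a @ t == NZero).
Definition InDn (a t : nterm) : form := Lt t (Length a) ∧ ¬ (Entry a t == NZero).

Definition InE (a : fterm) (t : nterm) : form := ExN (a @ #0 == Succ (nup t)).

(** [BarCantor B] says that the set of numbers [{#0 | B}] is a bar in Cantor
    space.  Numerical index 0 of [B] is the element of the set, the others are
    parameters: [#(i+1)] in [B] is [#i] outside.  Under the binders of the
    sequence, the length [n] and the code of the initial part, [B] is weakened
    accordingly. *)
Definition BarCantor (B : form) : form :=
  AllF (InCantor $0
        ⇒ ExN (ExN (InitSeg #0 $0 #1
                    ∧ subst (scons #0 (fun i => #(S (S i)))) (fun i => $(S i)) B))).

(** D_a for the number [a] coding the initial part of [$0] of length [m = #0]
    is a bar in Cantor space. *)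
Definition BarInitSeg : form :=
  ExN (InitSeg #0 $0 #1 ∧ BarCantor (InDn #1 #0)).

Definition FT : form :=
  AllF (BarCantor (InDf $0 #0) ⇒ ExN BarInitSeg).

Definition strongNegFT : form :=
  ExF (BarCantor (InDf $0 #0) ∧ AllN (¬ BarInitSeg)).

(** For every [γ] in Cantor space there is [n] with [(n, γ(n))] in E_α; here α
    is [$0], and it becomes [$1] below the quantifier over [γ]. *)
Definition MeetsAllCantor : form :=
  AllF (InCantor $0 ⇒ ExN (InE $1 ⟨#0, $0 @ #0⟩)).

Definition BothInE : form :=
  ExN (AllN (Lt #0 Two ⇒ InE $0 ⟨#1, #0⟩)).

Definition Sigma01_AC2_contra : form := AllF (MeetsAllCantor ⇒ BothInE).

Definition strongNegSigma01_AC2_contra : form := ExF (MeetsAllCantor ∧ ¬ BothInE).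

(* Main.v *)
From Stdlib Require Import List Arith Lia Cantor Ring.
From Stdlib Require Import Classical ClassicalEpsilon FunctionalExtensionality PropExtensionality.
Require Import Defs.
Import ListNotations.
Set Implicit Arguments.
Unset Strict Implicit.

(** The theorem is about derivations in a formal intuitionistic theory, and these are
    obtained from a completeness argument.  By [saturation], a context proves a
    formula if every saturated theory that contains the context contains the
    formula.  Saturated theories, here called worlds, decide their disjunctions
    and have witnesses for their existential statements.  Equality of numbers is
    decidable in BIM.  So the numerical terms modulo provable equality form a
    structure, [model_of], about which one can reason classically and with
    ordinary equality, as long as only decidable statements are concerned; for
    these the structure also satisfies induction ([w_ind_dec]).  Implications and
    universal quantifiers depend on later worlds, as in a Kripke model: they
    belong to a world if they hold in all worlds that share a suitable finite part
    of it.  This is [stably].  New functions are introduced by explicit definition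
    and by recursion so that their defining equations hold in all these worlds
    ([define], [define_rec]).

    The arithmetic needed is that every initial part of a function has a code
    ([exists_code]).  As codes are products of prime powers, this takes
    the infinity of primes and Euclid's lemma ([nextprime_spec], [euclid]).

    The mathematical content is in two reductions; each assigns to a function [a]
    a function [b].

    - [reduce_choice]: if [a] enumerates a set that every binary sequence meets,
      then the finite sequences that are seen to meet it by a search as long as the
      sequence form a decidable bar [b].  If a finite part of the bar is
      already a bar, only finitely many values of [a] matter, and the
      sequence that avoids them where it can must fail to avoid them at some
      [i]; then [(i, 0)] and [(i, 1)] have both been enumerated.

    - [reduce_fan]: let [a] be a decidable bar.  A node of the binary tree is
      secured at stage [m] if every path through it hits, by stage [m],
      the part of the bar known then.  Let [b] enumerate the pairs of a node and a direction
      such that, at some stage, the child in this direction is secured and the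
      other child is not; if the root is secured, let it enumerate all pairs.  A
      choice of a direction at each node is a path, which leads from the root
      to a secured node; at the last node before its initial parts are
      secured, its direction is enumerated.  But both directions cannot be
      enumerated for one node, unless the root is secured, and this means that
      a finite part of [a] is a bar.

    A reduction turns one principle into the other, and the function witnessing the
    strong negation of the second into one witnessing the strong negation of the
    first ([transfer]). *)

(** * Substitution *)

Notation shiftN := (fun i => #(S i)).
Notation upN s := (scons #0 (fun i => nup (s i))).
Notation upF s := (scons $0 (fun i => fup (s i))).

Lemma fsubst_id a : fsubst FVar a = a.
Proof. now destruct a. Qed.

Lemma fsubst_comp t2 t1 a :
  fsubst t2 (fsubst t1 a) = fsubst (fun i => fsubst t2 (t1 i)) a.
Proof. now destruct a. Qed.

Lemma nsubst_id t : nsubst NVar FVar t = t.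
Proof. induction t; simpl; rewrite ?fsubst_id; congruence. Qed.

Lemma nsubst_comp s2 t2 s1 t1 u :
  nsubst s2 t2 (nsubst s1 t1 u)
  = nsubst (fun i => nsubst s2 t2 (s1 i)) (fun i => fsubst t2 (t1 i)) u.
Proof. induction u; simpl; rewrite ?fsubst_comp; congruence. Qed.

Lemma scons_eta {X} (f : nat -> X) : scons (f 0) (fun i => f (S i)) = f.
Proof. apply functional_extensionality; now intros []. Qed.

Lemma scons_map {X Y} (h : X -> Y) x f :
  (fun i => h (scons x f i)) = scons (h x) (fun i => h (f i)).
Proof. apply functional_extensionality; now intros []. Qed.

Lemma nsubst_nup s t u : nsubst s t (nup u) = nsubst (fun i => s (S i)) t u.
Proof. unfold nup. now rewrite nsubst_comp. Qed.

Lemma nsubst_nup_f s t u : nsubst s t (nup_f u) = nsubst s (fun i => t (S i)) u.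
Proof. unfold nup_f. now rewrite nsubst_comp. Qed.

Lemma nup_nsubst s t u : nup (nsubst s t u) = nsubst (fun i => nup (s i)) t u.
Proof.
  unfold nup. rewrite nsubst_comp. f_equal.
  apply functional_extensionality; intro; apply fsubst_id.
Qed.

Lemma nup_f_nsubst s t u :
  nup_f (nsubst s t u) = nsubst (fun i => nup_f (s i)) (fun i => fup (t i)) u.
Proof. unfold nup_f, fup. now rewrite nsubst_comp. Qed.

Lemma fsubst_fup t a : fsubst t (fup a) = fsubst (fun i => t (S i)) a.
Proof. unfold fup. now rewrite fsubst_comp. Qed.

Lemma fup_fsubst t a : fup (fsubst t a) = fsubst (fun i => fup (t i)) a.
Proof. unfold fup. now rewrite fsubst_comp. Qed.

Lemma upN_comp s2 t2 s1 :
  (fun i => nsubst (upN s2) t2 (upN s1 i)) = upN (fun i => nsubst s2 t2 (s1 i)).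
Proof.
  rewrite scons_map. simpl. f_equal.
  apply functional_extensionality; intro i. now rewrite nsubst_nup, nup_nsubst.
Qed.

Lemma upF_comp t2 t1 :
  (fun i => fsubst (upF t2) (upF t1 i)) = upF (fun i => fsubst t2 (t1 i)).
Proof.
  rewrite scons_map. simpl. f_equal.
  apply functional_extensionality; intro i. now rewrite fsubst_fup, fup_fsubst.
Qed.

Lemma nup_f_comp s2 t2 (s1 : nat -> nterm) :
  (fun i => nsubst (fun j => nup_f (s2 j)) (upF t2) (nup_f (s1 i)))
  = (fun i => nup_f (nsubst s2 t2 (s1 i))).
Proof.
  apply functional_extensionality; intro i. now rewrite nsubst_nup_f, nup_f_nsubst.
Qed.

Lemma subst_comp A : forall s2 t2 s1 t1,
  subst s2 t2 (subst s1 t1 A)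
  = subst (fun i => nsubst s2 t2 (s1 i)) (fun i => fsubst t2 (t1 i)) A.
Proof.
  induction A; intros; simpl;
    rewrite ?IHA, ?IHA1, ?IHA2, ?nsubst_comp, ?fsubst_comp, ?upN_comp, ?upF_comp,
      ?nup_f_comp; reflexivity.
Qed.

Lemma upN_id : upN NVar = NVar.
Proof. exact (scons_eta NVar). Qed.

Lemma upF_id : upF FVar = FVar.
Proof. exact (scons_eta FVar). Qed.

Lemma subst_id A : subst NVar FVar A = A.
Proof.
  induction A; cbn [subst]; rewrite ?upN_id, ?upF_id, ?nsubst_id, ?fsubst_id; try congruence;
    f_equal; exact IHA.
Qed.

Lemma fsubst_eta (t : nat -> fterm) : (fun i => fsubst FVar (t i)) = t.
Proof. apply functional_extensionality; intro; apply fsubst_id. Qed.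

(** Formulas are handled below in the form [subst s t A], an open formula with an
    environment for its variables.  This lemma and the next make the
    instantiation of a quantifier an extension of the environment, so that no
    index arithmetic is left. *)
Lemma instN_subst s t A u : instN (subst (upN s) t A) u = subst (scons u s) t A.
Proof.
  unfold instN. rewrite subst_comp, scons_map, fsubst_eta. simpl. f_equal. f_equal.
  apply functional_extensionality; intro. rewrite nsubst_nup. apply nsubst_id.
Qed.

Lemma instF_subst s t A a :
  instF (subst (fun i => nup_f (s i)) (upF t) A) a = subst s (scons a t) A.
Proof.
  unfold instF. rewrite subst_comp, scons_map. simpl. f_equal.
  - apply functional_extensionality; intro. rewrite nsubst_nup_f. apply nsubst_id.
  - f_equal. apply functional_extensionality; intro. rewrite fsubst_fup. apply fsubst_id.
Qed.

Lemma subst_instN s t A u : subst s t (instN A u) = subst (scons (nsubst s t u) s) t A.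
Proof. unfold instN. now rewrite subst_comp, scons_map. Qed.

Lemma subst_instF s t A a : subst s t (instF A a) = subst s (scons (fsubst t a) t) A.
Proof. unfold instF. now rewrite subst_comp, scons_map. Qed.

Lemma subst_weakN s t A : subst s t (weakN A) = subst (fun i => s (S i)) t A.
Proof. unfold weakN. now rewrite subst_comp. Qed.

Lemma subst_weakF s t A : subst s t (weakF A) = subst s (fun i => t (S i)) A.
Proof. unfold weakF. now rewrite subst_comp. Qed.

Lemma weakN_subst s t A : weakN (subst s t A) = subst (fun i => nup (s i)) t A.
Proof. unfold weakN. now rewrite subst_comp, fsubst_eta. Qed.

Lemma weakF_subst s t A :
  weakF (subst s t A) = subst (fun i => nup_f (s i)) (fun i => fup (t i)) A.
Proof. unfold weakF. now rewrite subst_comp. Qed.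

(** * Weakening and substitution in derivations *)

Lemma prv_weaken G A : prv G A -> forall G', incl G G' -> prv G' A.
Proof.
  induction 1; intros G' Hi;
    assert (Hc : forall X : form, incl (X :: G) (X :: G'))
      by (intro; apply incl_cons; [now left | now apply incl_tl]).
  - now apply prv_ax.
  - apply prv_hyp; auto.
  - apply prv_botE; auto.
  - apply prv_impI; auto.
  - eapply prv_impE; eauto.
  - apply prv_andI; auto.
  - eapply prv_andE1; eauto.
  - eapply prv_andE2; eauto.
  - apply prv_orI1; auto.
  - apply prv_orI2; auto.
  - eapply prv_orE; eauto.
  - apply prv_allNI, IHprv. now apply incl_map.
  - apply prv_allNE; auto.
  - eapply prv_exNI; eauto.
  - eapply prv_exNE; [eauto|]. apply IHprv2, incl_cons; [now left|].
    now apply incl_tl, incl_map.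
  - apply prv_allFI, IHprv. now apply incl_map.
  - apply prv_allFE; auto.
  - eapply prv_exFI; eauto.
  - eapply prv_exFE; [eauto|]. apply IHprv2, incl_cons; [now left|].
    now apply incl_tl, incl_map.
  - apply prv_eqN_refl.
  - eapply prv_eqN_elim; eauto.
  - apply prv_eqF_refl.
  - eapply prv_eqF_elim; eauto.
Qed.

Lemma prv_cut G H C : (forall B, In B H -> prv G B) -> prv H C -> prv G C.
Proof.
  revert C; induction H as [|B H IH]; intros C HH HC.
  - apply (prv_weaken HC). intros ? [].
  - apply prv_impE with B.
    + apply IH; [intros; apply HH; now right | now apply prv_impI].
    + apply HH; now left.
Qed.

Lemma map_subst_weakN s t G :
  map (subst (upN s) t) (map weakN G) = map weakN (map (subst s t) G).
Proof.
  rewrite !map_map. apply map_ext; intro. now rewrite subst_weakN, weakN_subst.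
Qed.

Lemma map_subst_weakF s t G :
  map (subst (fun i => nup_f (s i)) (upF t)) (map weakF G)
  = map weakF (map (subst s t) G).
Proof.
  rewrite !map_map. apply map_ext; intro. now rewrite subst_weakF, weakF_subst.
Qed.

(** All axioms are closed, except for the parameters of induction, and there a
    substitution yields another instance of the scheme. *)
Lemma BIM_axiom_subst A : BIM_axiom A -> forall s t, BIM_axiom (subst s t A).
Proof.
  destruct 1; intros s t; try constructor.
  replace (subst s t _) with
    (instN (subst (upN s) t A) NZero
     ⇒ AllN (subst (upN s) t A
             ⇒ subst (scons (Succ #0) shiftN) FVar (subst (upN s) t A))
     ⇒ AllN (subst (upN s) t A)); [constructor|].
  simpl. rewrite subst_instN, instN_subst. f_equal. f_equal. f_equal. f_equal.
  rewrite !subst_comp, !scons_map, fsubst_eta. simpl. f_equal. f_equal.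
  apply functional_extensionality; intro. now rewrite nsubst_nup.
Qed.

Lemma prv_subst G A : prv G A -> forall s t, prv (map (subst s t) G) (subst s t A).
Proof.
  induction 1; intros s0 t0; simpl in *.
  - now apply prv_ax, BIM_axiom_subst.
  - apply prv_hyp. now apply in_map.
  - apply prv_botE; auto.
  - apply prv_impI; auto.
  - eapply prv_impE; eauto.
  - apply prv_andI; auto.
  - eapply prv_andE1; eauto.
  - eapply prv_andE2; eauto.
  - apply prv_orI1; auto.
  - apply prv_orI2; auto.
  - eapply prv_orE; eauto.
  - apply prv_allNI. rewrite <- map_subst_weakN. auto.
  - rewrite subst_instN, <- instN_subst. apply prv_allNE. apply IHprv.
  - apply prv_exNI with (nsubst s0 t0 t). rewrite instN_subst, <- subst_instN. auto.
  - eapply prv_exNE; [apply IHprv1|].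
    specialize (IHprv2 (upN s0) t0). rewrite map_subst_weakN, subst_weakN in IHprv2.
    now rewrite weakN_subst.
  - apply prv_allFI. rewrite <- map_subst_weakF. auto.
  - rewrite subst_instF, <- instF_subst. apply prv_allFE. apply IHprv.
  - apply prv_exFI with (fsubst t0 a). rewrite instF_subst, <- subst_instF. auto.
  - eapply prv_exFE; [apply IHprv1|].
    specialize (IHprv2 (fun i => nup_f (s0 i)) (upF t0)).
    rewrite map_subst_weakF, subst_weakF in IHprv2. now rewrite weakF_subst.
  - apply prv_eqN_refl.
  - specialize (IHprv1 s0 t0). specialize (IHprv2 s0 t0).
    rewrite subst_instN, <- instN_subst in *. eapply prv_eqN_elim; eauto.
  - apply prv_eqF_refl.
  - specialize (IHprv1 s0 t0). specialize (IHprv2 s0 t0).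
    rewrite subst_instF, <- instF_subst in *. eapply prv_eqF_elim; eauto.
Qed.

(** * Fresh variables *)

(** All variables of [A], of both sorts, are below [n]: the effect of a
    substitution on [A] depends only on its values there. *)
Definition bounded (n : nat) (A : form) : Prop :=
  forall s s' t t', (forall i, i < n -> s i = s' i /\ t i = t' i) ->
  subst s t A = subst s' t' A.

Lemma nterm_bounded u : exists n, forall s s' t t',
  (forall i, i < n -> s i = s' i /\ t i = t' i) -> nsubst s t u = nsubst s' t' u.
Proof.
  assert (Hf : forall a, exists n, forall t t', (forall i, i < n -> t i = t' i) ->
    fsubst t a = fsubst t' a).
  { intros [i|f]; [exists (S i)|exists 0]; simpl; auto. }
  induction u as [i| |a u [n IH]|u [n IH] v [m IH']].
  - exists (S i). intros s s' t t' E. apply E; lia.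
  - now exists 0.
  - destruct (Hf a) as [m Hm]. exists (n + m). intros s s' t t' E. simpl.
    rewrite (Hm t t'), (IH s s' t t'); auto; intros; apply E; lia.
  - exists (n + m). intros s s' t t' E. simpl.
    rewrite (IH s s' t t'), (IH' s s' t t'); auto; intros; apply E; lia.
Qed.

Lemma bounded_mono n m A : bounded n A -> n <= m -> bounded m A.
Proof. intros H Hle s s' t t' E. apply H. intros; apply E; lia. Qed.

Lemma exists_bound A : exists n, bounded n A.
Proof.
  induction A as [u v|a b| |A [n IA] B [m IB]|A [n IA] B [m IB]|A [n IA] B [m IB]
                 |A [n IA]|A [n IA]|A [n IA]|A [n IA]].
  - destruct (nterm_bounded u) as [n Hn], (nterm_bounded v) as [m Hm].
    exists (n + m). intros s s' t t' E. simpl.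
    rewrite (Hn s s' t t'), (Hm s s' t t'); auto; intros; apply E; lia.
  - destruct (nterm_bounded (a @ NZero)) as [n Hn], (nterm_bounded (b @ NZero)) as [m Hm].
    exists (n + m). intros s s' t t' E. simpl.
    assert (H1 := Hn s s' t t'); assert (H2 := Hm s s' t t'); simpl in *.
    assert (K : forall f g, f @ NZero = g @ NZero -> f = g) by congruence.
    f_equal; apply K; [apply H1|apply H2]; intros; apply E; lia.
  - exists 0. now intros ? ? ? ? ?.
  - exists (n + m). intros s s' t t' E. simpl.
    rewrite (IA s s' t t'), (IB s s' t t'); auto; intros; apply E; lia.
  - exists (n + m). intros s s' t t' E. simpl.
    rewrite (IA s s' t t'), (IB s s' t t'); auto; intros; apply E; lia.
  - exists (n + m). intros s s' t t' E. simpl.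
    rewrite (IA s s' t t'), (IB s s' t t'); auto; intros; apply E; lia.
  - exists n. intros s s' t t' E. simpl. f_equal. apply IA. intros [|i] Hi; simpl.
    + split; [reflexivity|]. now apply E.
    + split; [f_equal|]; apply E; lia.
  - exists n. intros s s' t t' E. simpl. f_equal. apply IA. intros [|i] Hi; simpl.
    + split; [reflexivity|]. now apply E.
    + split; [f_equal|]; apply E; lia.
  - exists n. intros s s' t t' E. simpl. f_equal. apply IA. intros [|i] Hi; simpl.
    + split; [f_equal; now apply E|reflexivity].
    + split; f_equal; apply E; lia.
  - exists n. intros s s' t t' E. simpl. f_equal. apply IA. intros [|i] Hi; simpl.
    + split; [f_equal; now apply E|reflexivity].
    + split; f_equal; apply E; lia.
Qed.

Lemma exists_bound_list G : exists n, forall A, In A G -> bounded n A.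
Proof.
  induction G as [|A G [n IH]]; [now exists 0|].
  destruct (exists_bound A) as [m Hm]. exists (n + m).
  intros B [<-|HB]; [apply (bounded_mono Hm)|apply (bounded_mono (IH _ HB))]; lia.
Qed.

(** The substitution that turns the fresh variable [c] into the variable bound
    next, and shifts the others. *)
Definition closeN (c i : nat) : nterm := if i =? c then #0 else #(S i).
Definition closeF (c i : nat) : fterm := if i =? c then $0 else $(S i).

Lemma closeN_weak c A : bounded c A -> subst (closeN c) FVar A = weakN A.
Proof.
  intro H. apply H. intros i Hi. unfold closeN.
  destruct (Nat.eqb_spec i c); [lia|auto].
Qed.

Lemma closeF_weak c A : bounded c A -> subst NVar (closeF c) A = weakF A.
Proof.
  intro H. apply H. intros i Hi. unfold closeF.
  destruct (Nat.eqb_spec i c); [lia|auto].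
Qed.

Lemma closeN_inst c A : bounded c A -> subst (closeN c) FVar (instN A #c) = A.
Proof.
  intro H. rewrite subst_instN. rewrite <- (subst_id A) at 2. apply H.
  intros [|i] Hi; simpl; unfold closeN; rewrite ?Nat.eqb_refl; auto.
  destruct (Nat.eqb_spec i c); [lia|auto].
Qed.

Lemma closeF_inst c A : bounded c A -> subst NVar (closeF c) (instF A $c) = A.
Proof.
  intro H. rewrite subst_instF. rewrite <- (subst_id A) at 2. apply H.
  intros [|i] Hi; simpl; unfold closeF; rewrite ?Nat.eqb_refl; auto.
  destruct (Nat.eqb_spec i c); [lia|auto].
Qed.

(** A theory that is built up in stages cannot shift its variables at every stage.
    The rules with a named fresh variable leave the context as it is; they follow
    from the original ones by the substitution [closeN c] or [closeF c]. *)
Lemma prv_allN_fresh c G A :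
  (forall B, In B G -> bounded c B) -> bounded c A -> prv G (instN A #c) -> prv G (AllN A).
Proof.
  intros HG HA H. apply prv_allNI. apply prv_subst with (s := closeN c) (t := FVar) in H.
  rewrite closeN_inst in H by trivial.
  now rewrite (map_ext_in _ weakN) in H by (intros; apply closeN_weak; auto).
Qed.

Lemma prv_allF_fresh c G A :
  (forall B, In B G -> bounded c B) -> bounded c A -> prv G (instF A $c) -> prv G (AllF A).
Proof.
  intros HG HA H. apply prv_allFI. apply prv_subst with (s := NVar) (t := closeF c) in H.
  rewrite closeF_inst in H by trivial.
  now rewrite (map_ext_in _ weakF) in H by (intros; apply closeF_weak; auto).
Qed.

Lemma prv_exN_fresh c G A C :
  (forall B, In B G -> bounded c B) -> bounded c A -> bounded c C ->
  prv G (ExN A) -> prv (instN A #c :: G) C -> prv G C.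
Proof.
  intros HG HA HC H1 H. apply (prv_exNE _ _ _ H1).
  apply prv_subst with (s := closeN c) (t := FVar) in H. simpl in H.
  rewrite closeN_inst, (closeN_weak HC) in H by trivial.
  now rewrite (map_ext_in _ weakN) in H by (intros; apply closeN_weak; auto).
Qed.

Lemma prv_exF_fresh c G A C :
  (forall B, In B G -> bounded c B) -> bounded c A -> bounded c C ->
  prv G (ExF A) -> prv (instF A $c :: G) C -> prv G C.
Proof.
  intros HG HA HC H1 H. apply (prv_exFE _ _ _ H1).
  apply prv_subst with (s := NVar) (t := closeF c) in H. simpl in H.
  rewrite closeF_inst, (closeF_weak HC) in H by trivial.
  now rewrite (map_ext_in _ weakF) in H by (intros; apply closeF_weak; auto).
Qed.

(** * Saturated theories *)

(** A disjunction or an existential statement belongs to such a theory only if a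
    disjunct or an instance does. *)

Record saturated (T : form -> Prop) : Prop := {
  sat_closed : forall G A, (forall B, In B G -> T B) -> prv G A -> T A;
  sat_consistent : ~ T Bot;
  sat_or : forall A B, T (Or A B) -> T A \/ T B;
  sat_exN : forall A, T (ExN A) -> exists t, T (instN A t);
  sat_exF : forall A, T (ExF A) -> exists a, T (instF A a) }.

Fixpoint code_pr (f : pr) : nat :=
  match f with
  | PId => to_nat (0, 0) | PZero => to_nat (0, 1) | PSucc => to_nat (0, 2)
  | PK => to_nat (0, 3) | PL => to_nat (0, 4)
  | PComp f g => to_nat (1, to_nat (code_pr f, code_pr g))
  | PPair f g => to_nat (2, to_nat (code_pr f, code_pr g))
  | PRec f g => to_nat (3, to_nat (code_pr f, code_pr g))
  end.

Definition code_fterm (a : fterm) : nat :=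
  match a with FVar i => to_nat (0, i) | FConst f => to_nat (1, code_pr f) end.

Fixpoint code_nterm (t : nterm) : nat :=
  match t with
  | NVar i => to_nat (0, i)
  | NZero => to_nat (1, 0)
  | NApp a u => to_nat (2, to_nat (code_fterm a, code_nterm u))
  | NJ u v => to_nat (3, to_nat (code_nterm u, code_nterm v))
  end.

Fixpoint code_form (A : form) : nat :=
  match A with
  | EqN s t => to_nat (0, to_nat (code_nterm s, code_nterm t))
  | EqF a b => to_nat (1, to_nat (code_fterm a, code_fterm b))
  | Bot => to_nat (2, 0)
  | Imp A B => to_nat (3, to_nat (code_form A, code_form B))
  | And A B => to_nat (4, to_nat (code_form A, code_form B))
  | Or A B => to_nat (5, to_nat (code_form A, code_form B))
  | AllN A => to_nat (6, code_form A)
  | ExN A => to_nat (7, code_form A)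
  | AllF A => to_nat (8, code_form A)
  | ExF A => to_nat (9, code_form A)
  end.

Lemma to_nat_pair_inj a b c d : to_nat (a, b) = to_nat (c, d) -> a = c /\ b = d.
Proof.
  intro H. apply (f_equal of_nat) in H. rewrite !cancel_of_to in H.
  now injection H.
Qed.

Ltac decode := repeat
  match goal with
  | H : to_nat (_, _) = to_nat (_, _) |- _ => apply to_nat_pair_inj in H as [? ?]
  end; try discriminate.

Lemma code_pr_inj f g : code_pr f = code_pr g -> f = g.
Proof.
  revert g. induction f; intros []; cbn -[to_nat]; intro; decode; f_equal; auto.
Qed.

Lemma code_fterm_inj a b : code_fterm a = code_fterm b -> a = b.
Proof.
  destruct a, b; cbn -[to_nat]; intro; decode; f_equal; auto using code_pr_inj.
Qed.

Lemma code_nterm_inj s t : code_nterm s = code_nterm t -> s = t.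
Proof.
  revert t. induction s; intros []; cbn -[to_nat]; intro; decode; f_equal;
    auto using code_fterm_inj.
Qed.

Lemma code_form_inj A B : code_form A = code_form B -> A = B.
Proof.
  revert B. induction A; intros []; cbn -[to_nat]; intro; decode; f_equal;
    auto using code_fterm_inj, code_nterm_inj.
Qed.

(** Only the first component of [k] determines the formula; so every formula comes
    up infinitely often, also after the stage at which it becomes provable. *)
Definition stage (k : nat) : form :=
  epsilon (inhabits Bot) (fun A => code_form A = fst (of_nat k)).

Lemma stage_recurrent A n : exists k, n <= k /\ stage k = A.
Proof.
  exists (to_nat (code_form A, n)). split.
  - apply Nat.le_trans with (n + code_form A); [lia|apply to_nat_non_decreasing].
  - apply code_form_inj. unfold stage.
    rewrite (epsilon_spec (inhabits Bot) (fun B => code_form B = fst (of_nat _))).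
    + now rewrite cancel_of_to.
    + exists A. now rewrite cancel_of_to.
Qed.

Definition witnessed (G : list form) (A : form) : Prop :=
  (forall B C, A = Or B C -> In B G \/ In C G) /\
  (forall B, A = ExN B -> exists t, In (instN B t) G) /\
  (forall B, A = ExF B -> exists a, In (instF B a) G).

Lemma witness_step C G A : ~ prv G C ->
  exists G', ~ prv G' C /\ incl G G' /\ (prv G A -> witnessed G' A).
Proof.
  intro HC. destruct (classic (prv G A)) as [HA|HA].
  2: { exists G. split; [|split]; [trivial|apply incl_refl|tauto]. }
  destruct (exists_bound_list (A :: C :: G)) as [c Hc].
  assert (HG : forall B, In B G -> bounded c B) by (intros; apply Hc; simpl; auto).
  assert (Hb : bounded c C) by (apply Hc; simpl; auto).
  assert (Ht : forall B, incl G (B :: G)) by (intro; apply incl_tl, incl_refl).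
  destruct A as [| | | | |A B| |B| |B];
    try (exists G; split; [|split]; [trivial|apply incl_refl|
         intros _; split; [|split]; intros; discriminate]).
  - destruct (classic (prv (A :: G) C)) as [H1|H1]; [|exists (A :: G)].
    + exists (B :: G). split; [|split; [apply Ht|]].
      * intro H2. apply HC. exact (prv_orE _ _ _ _ HA H1 H2).
      * intros _. split; [|split]; intros; try discriminate.
        right. left. congruence.
    + split; [trivial|split; [apply Ht|]].
      intros _. split; [|split]; intros; try discriminate.
      left. left. congruence.
  - destruct (exists_bound B) as [d Hd].
    assert (Hm : forall n X, bounded n X -> bounded (n + d) X)
      by (intros n X H; apply (bounded_mono H); lia).
    exists (instN B #(c + d) :: G). split; [|split; [apply Ht|]].
    + intro H. apply HC. apply prv_exN_fresh with (c := c + d) (3 := Hm _ _ Hb) in H; auto.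
      apply (bounded_mono Hd); lia.
    + intros _. split; [|split]; intros ? E; try discriminate.
      injection E as <-. exists #(c + d). now left.
  - destruct (exists_bound B) as [d Hd].
    assert (Hm : forall n X, bounded n X -> bounded (n + d) X)
      by (intros n X H; apply (bounded_mono H); lia).
    exists (instF B $(c + d) :: G). split; [|split; [apply Ht|]].
    + intro H. apply HC. apply prv_exF_fresh with (c := c + d) (3 := Hm _ _ Hb) in H; auto.
      apply (bounded_mono Hd); lia.
    + intros _. split; [|split]; intros ? E; try discriminate.
      injection E as <-. exists $(c + d). now left.
Qed.

(** Completeness for saturated theories.  A context that does not prove [C] is
    enlarged stage by stage, still without proving [C]: whenever a disjunction
    or an existential formula has become provable, one disjunct or a fresh
    instance is added.  The union of the stages is a saturated theory. *)
Lemma saturation G C :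
  (forall T, saturated T -> (forall B, In B G -> T B) -> T C) -> prv G C.
Proof.
  intro Hall. apply NNPP. intro HC.
  pose (ctx := {G' | ~ prv G' C}).
  assert (next : forall (X : ctx) A, {Y : ctx | incl (proj1_sig X) (proj1_sig Y) /\
    (prv (proj1_sig X) A -> witnessed (proj1_sig Y) A)}).
  { intros [X HX] A. apply constructive_indefinite_description.
    destruct (witness_step A HX) as (Y & HY & H1 & H2).
    now exists (exist _ Y HY). }
  pose (chain := fix chain k : ctx := match k with
    | 0 => exist _ G HC
    | S k => proj1_sig (next (chain k) (stage k)) end).
  pose (at_ k := proj1_sig (chain k)).
  assert (Hincl : forall k l, k <= l -> incl (at_ k) (at_ l)).
  { intros k l. induction 1 as [|l _ IH]; [apply incl_refl|].
    apply (incl_tran IH). unfold at_. cbn [chain].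
    exact (proj1 (proj2_sig (next (chain l) (stage l)))). }
  assert (Hno : forall k, ~ prv (at_ k) C) by (intro; exact (proj2_sig (chain k))).
  pose (T A := exists k, prv (at_ k) A).
  assert (Hwit : forall A, T A -> exists k, witnessed (at_ k) A).
  { intros A [k Hk]. destruct (stage_recurrent A k) as (l & Hl & E).
    exists (S l). unfold at_. cbn [chain].
    assert (H := proj2 (proj2_sig (next (chain l) (stage l)))). rewrite E in *.
    apply H, (prv_weaken Hk), (Hincl _ _ Hl). }
  assert (Hin : forall k A, In A (at_ k) -> T A)
    by (intros k A H; exists k; now apply prv_hyp).
  enough (HT : T C) by (destruct HT as [k Hk]; exact (Hno k Hk)).
  apply Hall; [split|].
  - intros H A HH HA.
    enough (exists k, forall B, In B H -> prv (at_ k) B) as [k Hk]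
      by (exists k; exact (prv_cut Hk HA)).
    clear HA. induction H as [|B H IH]; [now exists 0|].
    destruct IH as [k Hk]; [intros; apply HH; now right|].
    destruct (HH B) as [l Hl]; [now left|].
    exists (k + l). intros X [<-|HX].
    + apply (prv_weaken Hl), Hincl; lia.
    + apply (prv_weaken (Hk _ HX)), Hincl; lia.
  - intros [k Hk]. exact (Hno k (prv_botE _ _ Hk)).
  - intros A B H. destruct (Hwit _ H) as [k (Hw & _)].
    destruct (Hw A B eq_refl); eauto.
  - intros A H. destruct (Hwit _ H) as [k (_ & Hw & _)].
    destruct (Hw A eq_refl); eauto.
  - intros A H. destruct (Hwit _ H) as [k (_ & _ & Hw)].
    destruct (Hw A eq_refl); eauto.
  - intros B HB. now apply (Hin 0).
Qed.

(** * Worlds *)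

Record world := World { thy :> form -> Prop; thy_sat : saturated thy }.

(** [Q] holds in all worlds that contain a certain finite part of [w].  This is
    truth in all later worlds of a Kripke model, except that no single later
    world has to contain all of [w]; thus fresh variables never run out. *)
Definition stably (w : world) (Q : world -> Prop) : Prop :=
  exists G, (forall A, In A G -> w A) /\
    forall v : world, (forall A, In A G -> v A) -> Q v.

Section Forcing.
Implicit Types (w v : world) (A B : form) (s t : nterm).

(** ** Later worlds *)

Lemma stably_always w (Q : world -> Prop) : (forall v, Q v) -> stably w Q.
Proof. intro H. exists []. split; [intros ? []|auto]. Qed.

Lemma stably_thy w A : w A -> stably w (fun v => v A).
Proof.
  intro H. exists [A]. split; [intros B [<-|[]]; trivial|].
  intros v Hv. apply Hv. now left.
Qed.

Lemma stably_mono w (Q R : world -> Prop) :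
  stably w Q -> (forall v, Q v -> R v) -> stably w R.
Proof. intros (G & H & HQ) HR. exists G. auto. Qed.

Lemma stably_and w (Q R : world -> Prop) :
  stably w Q -> stably w R -> stably w (fun v => Q v /\ R v).
Proof.
  intros (G & HG & HQ) (H & HH & HR). exists (G ++ H). split.
  - intros A [HA|HA]%in_app_iff; auto.
  - intros v Hv. split; [apply HQ|apply HR]; intros A HA; apply Hv, in_app_iff; auto.
Qed.

Lemma stably_now w (Q : world -> Prop) : stably w Q -> Q w.
Proof. intros (G & H & HQ). auto. Qed.

Lemma stably_stably w (Q : world -> Prop) :
  stably w Q -> stably w (fun v => stably v Q).
Proof. intros (G & H & HQ). exists G. split; [trivial|]. intros v Hv. now exists G. Qed.

(** ** Membership in a world, connective by connective

    [And], [Or] and the existential quantifiers are decided within the world;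
    [Imp] and the universal quantifiers are introduced by an argument about
    later worlds. *)

Lemma valid_proves A : (forall w, w A) -> BIM_proves A.
Proof. intro H. apply saturation. intros T HT _. exact (H (World HT)). Qed.

Lemma w_closed w G A : (forall B, In B G -> w B) -> prv G A -> w A.
Proof. apply (sat_closed (thy_sat w)). Qed.

Lemma w_axiom w r f A : BIM_axiom A -> w (subst r f A).
Proof.
  intro H. apply w_closed with []; [intros ? []|].
  now apply prv_ax, BIM_axiom_subst.
Qed.

Lemma w_rule1 w A B : prv [A] B -> w A -> w B.
Proof. intros H HA. apply w_closed with (2 := H). intros X [<-|[]]; trivial. Qed.

Lemma w_rule2 w A B C : prv [A; B] C -> w A -> w B -> w C.
Proof.
  intros H HA HB. apply w_closed with (2 := H). intros X [<-|[<-|[]]]; trivial.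
Qed.

Ltac hyp := apply prv_hyp; simpl; tauto.

Lemma w_mp w A B : w (A ⇒ B) -> w A -> w B.
Proof. apply w_rule2. apply prv_impE with A; hyp. Qed.

Lemma w_imp w A B : stably w (fun v => v A -> v B) -> w (A ⇒ B).
Proof.
  intros (G & HG & H). apply (w_closed HG). apply prv_impI, saturation.
  intros T HT Hv. apply (H (World HT)); intros; apply Hv; simpl; auto.
Qed.

Lemma w_and w A B : w (A ∧ B) <-> w A /\ w B.
Proof.
  split.
  - intro H. split; revert H; apply w_rule1;
      [apply prv_andE1 with B | apply prv_andE2 with A]; hyp.
  - intros [HA HB]; revert HA HB. apply w_rule2. apply prv_andI; hyp.
Qed.

Lemma w_or w A B : w (Or A B) <-> w A \/ w B.
Proof.
  split; [apply (sat_or (thy_sat w))|].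
  intros [H|H]; revert H; apply w_rule1; [apply prv_orI1|apply prv_orI2]; hyp.
Qed.

Lemma w_not w A : w (¬ A) -> ~ w A.
Proof. intros H HA. exact (sat_consistent (thy_sat w) (w_mp H HA)). Qed.

Lemma w_all w r f A : w (subst r f (AllN A)) -> forall t, w (subst (scons t r) f A).
Proof.
  intros H t. revert H. apply w_rule1. rewrite <- instN_subst. apply prv_allNE. hyp.
Qed.

Lemma w_allF w r f A : w (subst r f (AllF A)) -> forall a, w (subst r (scons a f) A).
Proof.
  intros H t. revert H. apply w_rule1. rewrite <- instF_subst. apply prv_allFE. hyp.
Qed.

Lemma w_ex w r f A : w (subst r f (ExN A)) <-> exists t, w (subst (scons t r) f A).
Proof.
  split.
  - intro H. destruct (sat_exN (thy_sat w) H) as [t Ht].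
    exists t. now rewrite instN_subst in Ht.
  - intros [t H]. revert H. apply w_rule1. apply prv_exNI with t.
    rewrite instN_subst. hyp.
Qed.

Lemma w_exF w r f A : w (subst r f (ExF A)) <-> exists a, w (subst r (scons a f) A).
Proof.
  split.
  - intro H. destruct (sat_exF (thy_sat w) H) as [t Ht].
    exists t. now rewrite instF_subst in Ht.
  - intros [t H]. revert H. apply w_rule1. apply prv_exFI with t.
    rewrite instF_subst. hyp.
Qed.

(** A fresh variable of the finite part of [w] that is used is a generic instance. *)
Lemma w_all_intro w r f A :
  stably w (fun v => forall t, v (subst (scons t r) f A)) -> w (subst r f (AllN A)).
Proof.
  intros (G & HG & H). apply (w_closed HG). cbn [subst].
  set (A' := subst _ _ A).
  destruct (exists_bound_list (A' :: G)) as [c Hc]. apply prv_allN_fresh with c.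
  - intros; apply Hc; simpl; auto.
  - apply Hc; simpl; auto.
  - apply saturation. intros T HT Hv. unfold A'. rewrite instN_subst.
    now apply (H (World HT)).
Qed.

Lemma w_allF_intro w r f A :
  stably w (fun v => forall a, v (subst r (scons a f) A)) -> w (subst r f (AllF A)).
Proof.
  intros (G & HG & H). apply (w_closed HG). cbn [subst].
  set (A' := subst _ _ A).
  destruct (exists_bound_list (A' :: G)) as [c Hc]. apply prv_allF_fresh with c.
  - intros; apply Hc; simpl; auto.
  - apply Hc; simpl; auto.
  - apply saturation. intros T HT Hv. unfold A'. rewrite instF_subst.
    now apply (H (World HT)).
Qed.

Lemma w_all_imp w r f A B :
  stably w (fun v => forall t,
    v (subst (scons t r) f A) -> v (subst (scons t r) f B)) ->
  w (subst r f (AllN (A ⇒ B))).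
Proof.
  intro H. apply w_all_intro.
  apply (stably_mono (stably_stably H)). intros v Hv t.
  apply (w_imp (w := v)). apply (stably_mono Hv). auto.
Qed.

Lemma w_allF_imp w r f A B :
  stably w (fun v => forall a,
    v (subst r (scons a f) A) -> v (subst r (scons a f) B)) ->
  w (subst r f (AllF (A ⇒ B))).
Proof.
  intro H. apply w_allF_intro.
  apply (stably_mono (stably_stably H)). intros v Hv t.
  apply (w_imp (w := v)). apply (stably_mono Hv). auto.
Qed.

Lemma w_ind w r f A :
  w (subst (scons NZero r) f A) ->
  stably w (fun v => forall t,
    v (subst (scons t r) f A) -> v (subst (scons (Succ t) r) f A)) ->
  w (subst r f (AllN A)).
Proof.
  intros H0 HS.
  assert (H := w_axiom w NVar FVar (ax_ind (subst (upN r) f A))).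
  rewrite subst_id in H.
  rewrite instN_subst in H. apply (fun H => w_mp H H0) in H. apply (w_mp H).
  replace (AllN _) with
    (subst r f (AllN (A ⇒ subst (scons (Succ #0) shiftN) FVar A))).
  - apply w_all_imp. apply (stably_mono HS). intros v Hv t Ht.
    rewrite subst_comp, scons_map. exact (Hv t Ht).
  - cbn [subst]. rewrite !subst_comp, !scons_map, fsubst_eta.
    f_equal. f_equal. f_equal. f_equal.
    apply functional_extensionality; intro. now rewrite nsubst_nup.
Qed.

(** * Equality of numerical terms in a world *)

Lemma w_rewrite w s t r f A :
  w (s == t) -> w (subst (scons s r) f A) -> w (subst (scons t r) f A).
Proof.
  apply w_rule2. rewrite <- (instN_subst r f A s), <- (instN_subst r f A t).
  apply prv_eqN_elim with s; hyp.
Qed.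

Lemma w_refl w t : w (t == t).
Proof. apply w_closed with []; [intros ? []|apply prv_eqN_refl]. Qed.

Arguments w_rewrite {w s t} r f A.

Lemma w_sym w s t : w (s == t) -> w (t == s).
Proof.
  intro H. exact (w_rewrite (scons s NVar) FVar (#0 == #1) H (w_refl w s)).
Qed.

Lemma w_trans w s t u : w (s == t) -> w (t == u) -> w (s == u).
Proof.
  intros H H'. exact (w_rewrite (scons s NVar) FVar (#1 == #0) H' H).
Qed.

Lemma w_app w a s t : w (s == t) -> w (a @ s == a @ t).
Proof.
  intro H. exact (w_rewrite (scons s NVar) (scons a FVar) ($0 @ #1 == $0 @ #0) H
    (w_refl w (a @ s))).
Qed.

Lemma w_J w s t s' t' : w (s == s') -> w (t == t') -> w (⟨s, t⟩ == ⟨s', t'⟩).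
Proof.
  intros H H'. apply w_trans with ⟨s', t⟩.
  - exact (w_rewrite (scons ⟨s, t⟩ (scons t NVar)) FVar (#1 == ⟨#0, #2⟩) H (w_refl w _)).
  - exact (w_rewrite (scons ⟨s', t⟩ (scons s' NVar)) FVar (#1 == ⟨#2, #0⟩) H' (w_refl w _)).
Qed.

Lemma w_succ_neq0 w t : ~ w (Succ t == NZero).
Proof.
  apply w_not. exact (w_all (w_axiom w NVar FVar ax_S_neq_0) t).
Qed.

Lemma w_succ_inj w s t : w (Succ s == Succ t) -> w (s == t).
Proof.
  apply w_mp. exact (w_all (w_all (w_axiom w NVar FVar ax_S_inj) s) t).
Qed.

Lemma w_not_intro w A : stably w (fun v => ~ v A) -> w (¬ A).
Proof.
  intro H. apply w_imp. apply (stably_mono H). intros v Hv HA. now destruct Hv.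
Qed.

Lemma w_zero_or_succ w t : w (t == NZero) \/ exists u, w (t == Succ u).
Proof.
  assert (H : w (subst NVar FVar (AllN (Or (#0 == NZero) (ExN (#1 == Succ #0)))))).
  { apply w_ind.
    - apply (w_or w). left. apply w_refl.
    - apply stably_always. intros v s _. apply (w_or v). right.
      apply (w_ex v (scons (Succ s) NVar) FVar (#1 == Succ #0)). exists s. apply w_refl. }
  assert (Ht := w_all H t). apply (w_or w) in Ht as [Ht|Ht]; [now left|right].
  exact (proj1 (w_ex w (scons t NVar) FVar (#1 == Succ #0)) Ht).
Qed.

(** Equality is decidable, by induction on [t] and distinction of cases for [s]. *)
Lemma w_eq_dec w s t : w (s == t) \/ w (¬ s == t).
Proof.
  apply w_or.
  assert (H : w (subst NVar FVar (AllN (AllN (Or (#0 == #1) (¬ #0 == #1)))))).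
  2: exact (w_all (w_all H t) s).
  apply w_ind; [|apply stably_always; intros v y Hy]; apply w_all_intro;
    [apply stably_always; intros u x|apply (stably_mono (stably_thy Hy)); intros u Hu x];
    apply (w_or u); simpl; destruct (w_zero_or_succ u x) as [Hx|[x' Hx]].
  - now left.
  - right. apply w_not_intro. apply (stably_mono (stably_thy Hx)).
    intros z Hz H. exact (w_succ_neq0 (w_trans (w_sym Hz) H)).
  - right. apply w_not_intro. apply (stably_mono (stably_thy Hx)).
    intros z Hz H. exact (w_succ_neq0 (w_trans (w_sym H) Hz)).
  - assert (H := w_all Hu x'). apply (w_or u) in H as [H|H]; simpl in H.
    + left. apply (w_trans Hx). now apply w_app.
    + right. apply w_not_intro.
      apply (stably_mono (stably_and (stably_thy Hx) (stably_thy H))).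
      intros z [H1 H2] H3. apply (w_not H2). apply w_succ_inj.
      exact (w_trans (w_sym H1) H3).
Qed.

(** Decidability of [A] as a property of its variable [#0], in all later worlds *)
Definition dec_form w A : Prop :=
  stably w (fun v => forall t, v (instN A t) \/ v (¬ instN A t)).

Lemma dec_form_not w A t : dec_form w A -> (w (¬ instN A t) <-> ~ w (instN A t)).
Proof.
  intro H. split; [apply w_not|]. intro H'.
  destruct (stably_now H t); tauto.
Qed.

(** Induction can be used in a single world for a decidable [A]: the instance of
    the axiom scheme says that if [A] holds at [0] and fails somewhere, then it
    holds at some [y] and fails at its successor, and the world has a witness
    [y].  For other formulas the step would have to hold in all later worlds. *)
Lemma w_ind_dec w A : dec_form w A -> w (instN A NZero) ->
  (forall t, w (instN A t) -> w (instN A (Succ t))) -> forall t, w (instN A t).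
Proof.
  intros HA H0 HS t.
  pose (AS := subst (scons (Succ #0) shiftN) FVar A).
  assert (EAS : forall t, instN AS t = instN A (Succ t)).
  { intro u. unfold AS, instN. rewrite subst_comp, scons_map. reflexivity. }
  (* what holds in the world if [A] is not inductive *)
  pose (D := Or (¬ instN A NZero) (ExN (A ∧ ¬ AS))).
  assert (ED : forall t, instN (weakN D) t = D).
  { intro u. unfold instN. rewrite subst_weakN. apply subst_id. }
  assert (HD : forall v, v D <-> v (¬ instN A NZero) \/
            exists t, v (instN A t) /\ v (¬ instN A (Succ t))).
  { intro v. unfold D. rewrite w_or.
    assert (X := w_ex v NVar FVar (A ∧ ¬ AS)). rewrite subst_id in X. rewrite X.
    apply or_iff_compat_l.
    split; intros [u Hu]; exists u; revert Hu;
      change (subst (scons u NVar) FVar (A ∧ ¬ AS)) with (instN A u ∧ ¬ instN AS u);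
      now rewrite EAS, w_and. }
  assert (HB : forall v u, v (subst (scons u NVar) FVar (Or A (weakN D)))
                 <-> v (instN A u) \/ v D).
  { intros v u.
    change (v (Or (instN A u) (instN (weakN D) u)) <-> v (instN A u) \/ v D).
    rewrite ED. apply w_or. }
  assert (H : w (subst NVar FVar (AllN (Or A (weakN D))))).
  { apply w_ind.
    - apply HB. now left.
    - apply (stably_mono HA). intros v Hv u Hu. apply HB. apply HB in Hu.
      destruct Hu as [Hu|Hu]; [|now right].
      destruct (Hv (Succ u)) as [Hs|Hs]; [now left|].
      right. apply HD. right. now exists u. }
  assert (Ht := w_all H t). apply HB in Ht as [Ht|Ht]; [exact Ht|].
  apply HD in Ht as [Ht|(u & Hu & Hu')]; [destruct (w_not Ht H0)|].
  destruct (w_not Hu'). auto.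
Qed.

(** * Functions defined by terms and by recursion *)

(** The closure axioms only give functions without numerical parameters; constant
    functions are obtained by induction on the constant. *)
Lemma constant_function w t : exists a, stably w (fun v => forall u, v (a @ u == t)).
Proof.
  assert (H : w (subst NVar FVar (AllN (ExF (AllN ($0 @ #0 == #1)))))).
  { apply w_ind.
    - apply (w_exF w (scons NZero NVar) FVar). exists (FConst PZero).
      exact (w_axiom w (scons NZero NVar) FVar ax_Zero).
    - apply stably_always. intros v s Hs.
      apply (w_exF v (scons s NVar) FVar) in Hs as [a Ha].
      assert (Hc := w_axiom v NVar FVar ax_comp).
      assert (Hc' := w_allF (w_allF Hc PSucc) a).
      apply (w_exF v NVar (scons a (scons (FConst PSucc) FVar))) in Hc' as [b Hb].
      apply (w_exF v (scons (Succ s) NVar) FVar). exists b.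
      apply w_all_intro.
      apply (stably_mono (stably_and (stably_thy Ha) (stably_thy Hb))).
      intros u [H1 H2] x. assert (K1 := w_all H1 x). assert (K2 := w_all H2 x).
      simpl in *. apply (w_trans K2). now apply w_app. }
  assert (Ht := w_all H t). apply (w_exF w (scons t NVar) FVar) in Ht as [a Ha].
  exists a. apply (stably_mono (stably_thy Ha)). intros v Hv u.
  exact (w_all Hv u).
Qed.

(** Explicit definition, by induction on the term [u]; the environments [r] and [f]
    hold its parameters.  The equation persists in later worlds because
    the closure axioms assert it as one universal formula. *)
Lemma comprehension w r f u :
  exists a, stably w (fun v => forall t, v (a @ t == nsubst (scons t r) f u)).
Proof.
  induction u as [[|i]| |b u [a Ha]|u1 [a Ha] u2 [b Hb]].
  - exists (FConst PId). apply stably_always. intros v t.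
    exact (w_all (w_axiom v NVar FVar ax_Id) t).
  - exact (constant_function w (r i)).
  - exact (constant_function w NZero).
  - assert (Hc := w_axiom w NVar FVar ax_comp).
    assert (Hc' := w_allF (w_allF Hc (fsubst f b)) a).
    apply (w_exF w NVar (scons a (scons (fsubst f b) FVar))) in Hc' as [c Hc'].
    exists c. apply (stably_mono (stably_and Ha (stably_thy Hc'))).
    intros v [H1 H2] t. apply (w_trans (w_all H2 t)). simpl. now apply w_app.
  - assert (Hc := w_axiom w NVar FVar ax_pair).
    assert (Hc' := w_allF (w_allF Hc a) b).
    apply (w_exF w NVar (scons b (scons a FVar))) in Hc' as [c Hc'].
    exists c. apply (stably_mono (stably_and (stably_and Ha Hb) (stably_thy Hc'))).
    intros v [[H1 H2] H3] t. apply (w_trans (w_all H3 t)). simpl. now apply w_J.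
Qed.

Lemma recursion w a b :
  exists c, stably w (fun v => forall t, v (c @ ⟨t, NZero⟩ == a @ t) /\
    forall n, v (c @ ⟨t, Succ n⟩ == b @ ⟨⟨t, n⟩, c @ ⟨t, n⟩⟩)).
Proof.
  assert (Hc := w_axiom w NVar FVar ax_rec).
  assert (Hc' := w_allF (w_allF Hc a) b).
  apply (w_exF w NVar (scons b (scons a FVar))) in Hc' as [c Hc'].
  exists c. apply (stably_mono (stably_thy Hc')). intros v Hv t.
  assert (K : forall n, v (c @ ⟨t, NZero⟩ == a @ t) /\
                v (c @ ⟨t, Succ n⟩ == b @ ⟨⟨t, n⟩, c @ ⟨t, n⟩⟩)).
  { intro n. apply w_and. exact (w_all (w_all Hv t) n). }
  split; [exact (proj1 (K NZero))|]. intro n. apply K.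
Qed.

End Forcing.

(** * The structure of a world *)

(** The predicates for which induction is available in a single world.  Bounded
    quantifiers are absent because they can be eliminated ([dec_ball]), once
    there is some arithmetic. *)
Inductive decidable (D : Type) (F : (D -> D) -> Prop) : (D -> Prop) -> Prop :=
| dec_eq f g : F f -> F g -> decidable F (fun x => f x = g x)
| dec_and P Q : decidable F P -> decidable F Q -> decidable F (fun x => P x /\ Q x)
| dec_not P : decidable F P -> decidable F (fun x => ~ P x)
| dec_iff P Q : decidable F P -> (forall x, Q x <-> P x) -> decidable F Q.

(** What the numbers and functions of a single world satisfy, stated in
    the logic of the metatheory: primitive recursive arithmetic relative to the
    class [fn] of those functions that the world contains. *)
Record model := Model {
  dom :> Type;
  zero : dom;
  pair : dom -> dom -> dom;
  ev : pr -> dom -> dom;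
  fn : (dom -> dom) -> Prop;
  ev_Id x : ev PId x = x;
  ev_Zero x : ev PZero x = zero;
  succ_neq0 x : ev PSucc x <> zero;
  succ_inj x y : ev PSucc x = ev PSucc y -> x = y;
  ev_K x y : ev PK (pair x y) = x;
  ev_L x y : ev PL (pair x y) = y;
  pair_KL x : pair (ev PK x) (ev PL x) = x;
  ev_comp f g x : ev (PComp f g) x = ev f (ev g x);
  ev_pair f g x : ev (PPair f g) x = pair (ev f x) (ev g x);
  ev_rec0 f g x : ev (PRec f g) (pair x zero) = ev f x;
  ev_recS f g x n : ev (PRec f g) (pair x (ev PSucc n))
                    = ev g (pair (pair x n) (ev (PRec f g) (pair x n)));
  fn_ev f : fn (ev f);
  fn_const c : fn (fun _ => c);
  fn_comp f g : fn f -> fn g -> fn (fun x => f (g x));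
  fn_pair f g : fn f -> fn g -> fn (fun x => pair (f x) (g x));
  fn_rec f g : fn f -> fn g -> exists h, fn h /\
    forall x, h (pair x zero) = f x /\
      forall n, h (pair x (ev PSucc n)) = g (pair (pair x n) (h (pair x n)));
  induction P : decidable fn P -> P zero -> (forall x, P x -> P (ev PSucc x)) ->
    forall x, P x }.

(** ** Terms modulo provable equality *)

Section Quotient.
Variable w : world.

Definition eq_class (t : nterm) : nterm -> Prop := fun s => w (t == s).

Definition number : Type := {P : nterm -> Prop | exists t, P = eq_class t}.

Definition cls (t : nterm) : number := exist _ (eq_class t) (ex_intro _ t eq_refl).

Lemma cls_eq s t : cls s = cls t <-> w (s == t).
Proof.
  split.
  - intro H. injection H as H. change (eq_class s t). rewrite H. apply w_refl.
  - intro H.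
    assert (E : eq_class s = eq_class t).
    { apply functional_extensionality; intro u. apply propositional_extensionality.
      split; apply w_trans; [now apply w_sym|trivial]. }
    unfold cls. apply eq_sig_hprop; [intros; apply proof_irrelevance|exact E].
Qed.

Lemma cls_surj x : exists t, x = cls t.
Proof.
  destruct x as [P [t Ht]]. exists t.
  apply eq_sig_hprop; [intros; apply proof_irrelevance|exact Ht].
Qed.

Definition rep (x : number) : nterm :=
  proj1_sig (constructive_indefinite_description _ (cls_surj x)).

Lemma cls_rep x : cls (rep x) = x.
Proof.
  unfold rep. now destruct (constructive_indefinite_description _ (cls_surj x)).
Qed.

Definition app (a : fterm) (x : number) : number := cls (a @ rep x).

Lemma cls_app a t : cls (a @ t) = app a (cls t).
Proof. apply cls_eq, w_app. apply cls_eq. now rewrite cls_rep. Qed.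

Definition npair (x y : number) : number := cls ⟨rep x, rep y⟩.

Lemma cls_pair s t : cls ⟨s, t⟩ = npair (cls s) (cls t).
Proof. apply cls_eq, w_J; apply cls_eq; now rewrite cls_rep. Qed.

Lemma cls_all (P : number -> Prop) : (forall t, P (cls t)) -> forall x, P x.
Proof. intros H x. now destruct (cls_surj x) as [t ->]. Qed.

Definition is_app (f : number -> number) : Prop := exists a, f = app a.

Lemma is_app_term f r g u :
  (forall t, f (cls t) = cls (nsubst (scons t r) g u)) -> is_app f.
Proof.
  intro H. destruct (comprehension w r g u) as [a Ha]. exists a.
  apply functional_extensionality, cls_all. intro t.
  rewrite H, <- cls_app. apply cls_eq, w_sym. apply (stably_now Ha).
Qed.

Lemma decidable_form P : decidable is_app P ->
  exists A, dec_form w A /\ forall t, P (cls t) <-> w (instN A t).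
Proof.
  induction 1 as [f g [a ->] [b ->]|P Q _ (A & HA & EA) _ (B & HB & EB)
                 |P _ (A & HA & EA)|P Q _ (A & HA & EA) E].
  - exists (a @ #0 == b @ #0).
    assert (X : forall t, instN (a @ #0 == b @ #0) t = (a @ t == b @ t)).
    { intro t. unfold instN. simpl. now rewrite !fsubst_id. }
    split.
    + apply stably_always. intros v t. rewrite X. apply w_eq_dec.
    + intro t. now rewrite X, <- cls_eq, !cls_app.
  - exists (A ∧ B).
    assert (X : forall t, instN (A ∧ B) t = (instN A t ∧ instN B t)) by reflexivity.
    split.
    + apply (stably_mono (stably_stably (stably_and HA HB))). intros v Hv t.
      rewrite X. destruct (stably_now Hv) as [H1 H2].
      destruct (H1 t) as [H3|H3]; [destruct (H2 t) as [H4|H4]|].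
      * left. now apply w_and.
      * right. apply w_not_intro. apply (stably_mono (stably_thy H4)).
        intros u Hu HAB. apply (w_not Hu). now apply w_and in HAB.
      * right. apply w_not_intro. apply (stably_mono (stably_thy H3)).
        intros u Hu HAB. apply (w_not Hu). now apply w_and in HAB.
    + intro t. now rewrite X, w_and, EA, EB.
  - exists (¬ A). split.
    + apply (stably_mono HA). intros v Hv t. change (instN (¬ A) t) with (¬ instN A t).
      destruct (Hv t) as [H|H]; [right|now left].
      apply w_not_intro. apply (stably_mono (stably_thy H)).
      intros u Hu HN. exact (w_not HN Hu).
    + intro t. rewrite EA. symmetry. exact (dec_form_not t HA).
  - exists A. split; [trivial|]. intro t. now rewrite E.
Qed.

(** Truth of the axioms in the quotient is membership of their instances in [w].
    Only recursion and induction require an idea, and these are [recursion] and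
    [w_ind_dec]. *)
Definition model_of : model.
Proof.
  unshelve refine (@Model number (cls NZero) npair (fun f => app (FConst f)) is_app
    _ _ _ _ _ _ _ _ _ _ _ _ _ _ _ _ _).
  - apply cls_all. intro t. rewrite <- cls_app. apply cls_eq.
    exact (w_all (w_axiom w NVar FVar ax_Id) t).
  - apply cls_all. intro t. rewrite <- cls_app. apply cls_eq.
    exact (w_all (w_axiom w NVar FVar ax_Zero) t).
  - apply (cls_all (P := fun x => app PSucc x <> cls NZero)). intro t.
    rewrite <- cls_app, cls_eq. apply w_succ_neq0.
  - intros x y. destruct (cls_surj x) as [s ->], (cls_surj y) as [t ->].
    rewrite <- !cls_app, !cls_eq. apply w_succ_inj.
  - intros x y. destruct (cls_surj x) as [s ->], (cls_surj y) as [t ->].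
    rewrite <- cls_pair, <- cls_app. apply cls_eq.
    exact (w_all (w_all (w_axiom w NVar FVar ax_KJ) s) t).
  - intros x y. destruct (cls_surj x) as [s ->], (cls_surj y) as [t ->].
    rewrite <- cls_pair, <- cls_app. apply cls_eq.
    exact (w_all (w_all (w_axiom w NVar FVar ax_LJ) s) t).
  - apply cls_all. intro t. rewrite <- !cls_app, <- cls_pair. apply cls_eq.
    exact (w_all (w_axiom w NVar FVar ax_JKL) t).
  - intros f g. apply cls_all. intro t. rewrite <- !cls_app. apply cls_eq.
    exact (w_all (w_axiom w NVar FVar (ax_PComp f g)) t).
  - intros f g. apply cls_all. intro t. rewrite <- !cls_app, <- cls_pair. apply cls_eq.
    exact (w_all (w_axiom w NVar FVar (ax_PPair f g)) t).
  - intros f g. apply cls_all. intro t. rewrite <- cls_pair, <- !cls_app. apply cls_eq.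
    exact (w_all (w_axiom w NVar FVar (ax_PRec_0 f g)) t).
  - intros f g x y. destruct (cls_surj x) as [s ->], (cls_surj y) as [t ->].
    repeat first [rewrite <- cls_app | rewrite <- cls_pair].
    apply cls_eq.
    exact (w_all (w_all (w_axiom w NVar FVar (ax_PRec_S f g)) s) t).
  - intro f. now exists (FConst f).
  - intro c. destruct (cls_surj c) as [s ->].
    apply (is_app_term (r := scons s NVar) (g := FVar) (u := #1)). reflexivity.
  - intros f g [a ->] [b ->].
    apply (is_app_term (r := NVar) (g := scons a (scons b FVar)) (u := $0 @ ($1 @ #0))).
    intro t. simpl. now rewrite !cls_app.
  - intros f g [a ->] [b ->].
    apply (is_app_term (r := NVar) (g := scons a (scons b FVar)) (u := ⟨$0 @ #0, $1 @ #0⟩)).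
    intro t. simpl. now rewrite cls_pair, !cls_app.
  - intros f g [a ->] [b ->]. destruct (recursion w a b) as [c Hc].
    apply stably_now in Hc. exists (app c). split; [now exists c|].
    intro x. destruct (cls_surj x) as [s ->]. destruct (Hc s) as [H0 HS]. split.
    + rewrite <- cls_pair, <- !cls_app. now apply cls_eq.
    + intro y. destruct (cls_surj y) as [t ->].
      repeat first [rewrite <- cls_app | rewrite <- cls_pair].
      now apply cls_eq.
  - intros P HP H0 HS. destruct (decidable_form HP) as (A & HA & EA).
    apply cls_all. intro t. apply EA. apply (w_ind_dec HA).
    + now apply EA.
    + intros s Hs. apply EA. unfold Succ. rewrite cls_app. now apply HS, EA.
Defined.

End Quotient.

(** * Arithmetic in a model *)

Declare Scope model_scope.
Notation succ := (ev PSucc).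

Ltac ev_simpl := repeat first
  [ rewrite ev_comp | rewrite ev_pair | rewrite ev_K | rewrite ev_L
  | rewrite ev_Id | rewrite ev_Zero ].

Section Arithmetic.
Variable M : model.
Implicit Types (x y z n m d : M) (P Q : M -> Prop).

Definition add x y : M := ev padd (pair x y).
Definition mul x y : M := ev pmul (pair x y).
Definition pred x : M := ev ppred x.
Definition sub x y : M := ev psub (pair x y).
Definition pow x n : M := ev ppow (pair x n).
Definition one : M := succ (zero M).
Definition two : M := succ one.
Definition le x y : Prop := sub x y = zero M.
Definition lt x y : Prop := le (succ x) y.

End Arithmetic.

Arguments one {M}.
Arguments two {M}.
Notation "0" := (zero _) : model_scope.
Notation "1" := one : model_scope.
Notation "2" := two : model_scope.
Infix "+" := add : model_scope.
Infix "*" := mul : model_scope.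
Infix "-" := sub : model_scope.
Infix "^" := pow : model_scope.
Infix "<=" := le : model_scope.
Infix "<" := lt : model_scope.
Local Open Scope model_scope.

Lemma fn_id (M : model) : fn (fun x : M => x).
Proof.
  replace (fun x : M => x) with (ev (m := M) PId); [apply fn_ev|].
  apply functional_extensionality; intro. apply ev_Id.
Qed.

(** [fn] shows that a function given by an expression belongs to the model, [dec]
    that a predicate is decidable, and [ind] starts an induction.  [dec_ext]
    stands for the bounded quantifier, which is treated only after [dec_ball]. *)
Ltac fn_core := lazymatch goal with
  | |- fn (fun x => x) => apply fn_id
  | |- fn (fun _ => ?c) => apply fn_const
  | |- fn (fun x => ev ?f (@?u x)) => apply (fn_comp (f := ev f) (g := u)); [apply fn_ev|fn_core]
  | |- fn (fun x => pair (@?u x) (@?v x)) => apply (fn_pair (f := u) (g := v)); fn_core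
  | H : fn ?h |- fn (fun x => ?h (@?u x)) => apply (fn_comp (f := h) (g := u)); [exact H|fn_core]
  | _ => assumption
  end.
Ltac fn := cbv beta delta [add mul pred sub pow one two]; fn_core.

Lemma dec_or (M : model) (P Q : M -> Prop) :
  decidable (@fn M) P -> decidable (@fn M) Q -> decidable (@fn M) (fun x => P x \/ Q x).
Proof.
  intros HP HQ. apply dec_iff with (fun x => ~ (~ P x /\ ~ Q x)).
  - apply dec_not. apply (dec_and (P := fun x => ~ P x) (Q := fun x => ~ Q x)); now apply dec_not.
  - intro x. tauto.
Qed.

Lemma dec_imp (M : model) (P Q : M -> Prop) :
  decidable (@fn M) P -> decidable (@fn M) Q -> decidable (@fn M) (fun x => P x -> Q x).
Proof.
  intros HP HQ. apply dec_iff with (fun x => ~ (P x /\ ~ Q x)).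
  - apply dec_not. apply (dec_and (P := P) (Q := fun x => ~ Q x)); now try apply dec_not.
  - intro x. tauto.
Qed.

Ltac dec_ext := fail.
Ltac dec := lazymatch goal with
  | |- decidable _ (fun x => @?u x = @?v x) => apply (dec_eq (f := u) (g := v)); fn
  | |- decidable _ (fun x => le (@?u x) (@?v x)) => cbv beta delta [le]; dec
  | |- decidable _ (fun x => lt (@?u x) (@?v x)) => cbv beta delta [lt le]; dec
  | |- decidable _ (fun x => @?P x /\ @?Q x) => apply (dec_and (P := P) (Q := Q)); cbv beta; dec
  | |- decidable _ (fun x => @?P x \/ @?Q x) => apply (dec_or (P := P) (Q := Q)); cbv beta; dec
  | |- decidable _ (fun x => ~ @?P x) => apply (dec_not (P := P)); cbv beta; dec
  | |- decidable _ (fun x => @?P x -> @?Q x) => apply (dec_imp (P := P) (Q := Q)); cbv beta; dec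
  | _ => dec_ext
  end.

Ltac ind x := pattern x; apply induction; clear x; [cbv beta; dec| |intros x IH].

Section Arithmetic.
Variable M : model.
Implicit Types (x y z n m d : M) (P Q : M -> Prop).

Lemma add_0 x : x + 0 = x.
Proof. unfold add, padd. now rewrite ev_rec0, ev_Id. Qed.

Lemma add_S x y : x + succ y = succ (x + y).
Proof. unfold add, padd, rr. rewrite ev_recS. now ev_simpl. Qed.

Lemma add_0l x : 0 + x = x.
Proof. ind x; [apply add_0|]. now rewrite add_S, IH. Qed.

Lemma add_Sl x y : succ x + y = succ (x + y).
Proof. ind y; [now rewrite !add_0|]. now rewrite !add_S, IH. Qed.

Lemma addC x y : x + y = y + x.
Proof. ind y; [now rewrite add_0, add_0l|]. now rewrite add_S, add_Sl, IH. Qed.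

Lemma addA x y z : x + (y + z) = x + y + z.
Proof. ind z; [now rewrite !add_0|]. now rewrite !add_S, IH. Qed.

Lemma mul_0 x : x * 0 = 0.
Proof. unfold mul, pmul. now rewrite ev_rec0, ev_Zero. Qed.

Lemma mul_S x y : x * succ y = x * y + x.
Proof. unfold mul, pmul, rr, rx. rewrite ev_recS. now ev_simpl. Qed.

Lemma mul_0l x : 0 * x = 0.
Proof. ind x; [apply mul_0|]. now rewrite mul_S, IH, add_0. Qed.

Lemma mulDr x y z : x * (y + z) = x * y + x * z.
Proof. ind z; [now rewrite mul_0, !add_0|]. now rewrite add_S, !mul_S, IH, addA. Qed.

Lemma mul_1 x : x * 1 = x.
Proof. unfold one. now rewrite mul_S, mul_0, add_0l. Qed.

Lemma mul_Sl x y : succ x * y = x * y + y.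
Proof.
  ind y; [now rewrite !mul_0, add_0|].
  rewrite !mul_S, IH, !add_S, <- !addA. f_equal. f_equal. apply addC.
Qed.

Lemma mulC x y : x * y = y * x.
Proof. ind y; [now rewrite mul_0, mul_0l|]. now rewrite mul_S, mul_Sl, IH. Qed.

Lemma mulA x y z : x * (y * z) = x * y * z.
Proof. ind z; [now rewrite !mul_0|]. now rewrite !mul_S, mulDr, IH. Qed.

Lemma model_semiring : semi_ring_theory (zero M) one (@add M) (@mul M) eq.
Proof.
  split; intros.
  - apply add_0l.
  - apply addC.
  - apply addA.
  - rewrite mulC. apply mul_1.
  - apply mul_0l.
  - apply mulC.
  - apply mulA.
  - rewrite mulC, mulDr. f_equal; apply mulC.
Qed.

Add Ring model_ring : model_semiring.

Lemma succ_add x : succ x = x + 1.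
Proof. unfold one. now rewrite add_S, add_0. Qed.

(** ** Order *)

Lemma pred_0 : pred (zero M) = 0.
Proof.
  unfold pred, ppred, pnatrec. ev_simpl. now rewrite ev_rec0, ev_Zero.
Qed.

Lemma pred_S x : pred (succ x) = x.
Proof. unfold pred, ppred, pnatrec, rn. ev_simpl. rewrite ev_recS. now ev_simpl. Qed.

Lemma zero_or_succ x : x = 0 \/ exists y, x = succ y.
Proof.
  enough (x = 0 \/ x = succ (pred x)) by firstorder.
  ind x; [now left|]. right. now rewrite pred_S.
Qed.

Lemma sub_0 x : x - 0 = x.
Proof. unfold sub, psub. now rewrite ev_rec0, ev_Id. Qed.

Lemma sub_S x y : x - succ y = pred (x - y).
Proof. unfold sub, psub, rr. rewrite ev_recS. now ev_simpl. Qed.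

Lemma sub_SS x y : succ x - succ y = x - y.
Proof.
  ind y; [now rewrite sub_S, !sub_0, pred_S|]. now rewrite sub_S, IH, <- sub_S.
Qed.

Lemma sub_0l x : 0 - x = 0.
Proof. ind x; [apply sub_0|]. now rewrite sub_S, IH, pred_0. Qed.

Lemma sub_add x y : x + y - x = y.
Proof. ind x; [now rewrite add_0l, sub_0|]. now rewrite add_Sl, sub_SS. Qed.

Lemma sub_add0 x y : x - (x + y) = 0.
Proof. ind x; [apply sub_0l|]. now rewrite add_Sl, sub_SS. Qed.

(** With the truncated differences as witnesses, comparability is a decidable
    statement, and can be shown by induction. *)
Lemma add_or x y : (exists d, x = y + d) \/ exists d, y = x + d.
Proof.
  enough (x = y + (x - y) \/ y = x + (y - x)) by firstorder.
  ind y.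
  - left. now rewrite add_0l, sub_0.
  - destruct IH as [E|E].
    + destruct (zero_or_succ (x - y)) as [H|[e H]].
      * right. rewrite H, add_0 in E. subst x.
        rewrite (succ_add y), sub_add. reflexivity.
      * left. rewrite sub_S, H, pred_S. rewrite H, add_S, <- add_Sl in E. exact E.
    + right. rewrite E at 2. rewrite <- add_S, sub_add. now rewrite add_S, <- E.
Qed.

Lemma le_ex x y : x <= y <-> exists d, y = x + d.
Proof.
  unfold le. split.
  - intro H. destruct (add_or x y) as [[d E]|E]; [|exact E].
    subst x. rewrite sub_add in H. subst d. exists 0. now rewrite !add_0.
  - intros [d ->]. apply sub_add0.
Qed.

Lemma lt_ex x y : x < y <-> exists d, y = succ (x + d).
Proof.
  unfold lt. rewrite le_ex. split; intros [d ->]; exists d; now rewrite add_Sl.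
Qed.

Lemma le_refl x : x <= x.
Proof. apply le_ex. exists 0. now rewrite add_0. Qed.

Lemma le_0 x : 0 <= x.
Proof. apply sub_0l. Qed.

Lemma le_add x y : x <= x + y.
Proof. apply sub_add0. Qed.

Lemma le_succ x : x <= succ x.
Proof. rewrite succ_add. apply le_add. Qed.

Lemma le_trans x y z : x <= y -> y <= z -> x <= z.
Proof.
  rewrite !le_ex. intros [d ->] [e ->]. exists (d + e). apply eq_sym, addA.
Qed.

Lemma lt_succ x y : x < succ y <-> x <= y.
Proof. unfold lt, le. now rewrite sub_SS. Qed.

Lemma lt_succ_le x y : x < succ y -> x <= y.
Proof. apply lt_succ. Qed.

Lemma lt_le x y : x < y -> x <= y.
Proof. intro H. apply (le_trans (le_succ x) H). Qed.

Lemma lt_le_trans x y z : x < y -> y <= z -> x < z.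
Proof. apply le_trans. Qed.

Lemma le_lt_trans x y z : x <= y -> y < z -> x < z.
Proof. rewrite <- lt_succ. unfold lt. intros. eapply le_trans; eauto. Qed.

Lemma lt_trans x y z : x < y -> y < z -> x < z.
Proof. intros H H'. exact (lt_le_trans H (lt_le H')). Qed.

Lemma le_0_eq x : x <= 0 -> x = 0.
Proof. unfold le. now rewrite sub_0. Qed.

Lemma lt_0 x : ~ x < 0.
Proof. intro H. apply le_0_eq in H. exact (succ_neq0 H). Qed.

Lemma lt_irrefl x : ~ x < x.
Proof.
  ind x; [apply lt_0|]. unfold lt, le in *. now rewrite sub_SS.
Qed.

Lemma le_or_lt x y : x <= y \/ y < x.
Proof.
  destruct (add_or x y) as [[d ->]|[d ->]]; [|left; apply le_add].
  destruct (zero_or_succ d) as [->|[e ->]].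
  - left. rewrite add_0. apply le_refl.
  - right. apply lt_ex. exists e. apply add_S.
Qed.

Lemma le_antisym x y : x <= y -> y <= x -> x = y.
Proof.
  intros H H'. apply le_ex in H as [d ->].
  destruct (zero_or_succ d) as [->|[e ->]]; [now rewrite add_0|].
  rewrite add_S in H'. destruct (lt_irrefl (x := x)).
  apply (le_lt_trans (le_add x e)). exact H'.
Qed.

Lemma le_eq_or_lt x y : x <= y -> x = y \/ x < y.
Proof.
  intro H. destruct (le_or_lt y x); [left; now apply le_antisym|now right].
Qed.

Lemma lt_not_le x y : x < y -> ~ y <= x.
Proof. intros H H'. exact (lt_irrefl (lt_le_trans H H')). Qed.

Lemma neq0_lt x : x <> 0 <-> 0 < x.
Proof.
  split.
  - intro H. destruct (zero_or_succ x) as [->|[y ->]]; [tauto|].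
    apply lt_succ, le_0.
  - intros H ->. exact (lt_irrefl H).
Qed.

Lemma lt_1 x : x < 1 <-> x = 0.
Proof.
  unfold one. rewrite lt_succ. split; [apply le_0_eq|intros ->; apply le_refl].
Qed.

Lemma lt_2 x : x < 2 <-> x = 0 \/ x = 1.
Proof.
  unfold two. rewrite lt_succ. split.
  - intro H. destruct (le_eq_or_lt H) as [->|H']; [now right|left]. now apply lt_1.
  - intros [->| ->]; [apply le_0|apply le_refl].
Qed.

Lemma one_neq0 : (1 : M) <> 0.
Proof. apply succ_neq0. Qed.

Lemma add_cancel x y z : x + y = x + z -> y = z.
Proof. intro H. rewrite <- (sub_add x y), H. apply sub_add. Qed.

Lemma add_eq0 x y : x + y = 0 <-> x = 0 /\ y = 0.
Proof.
  split; [|intros [-> ->]; apply add_0].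
  intro H. enough (x = 0) as -> by (now rewrite add_0l in H).
  apply le_0_eq. rewrite <- H. apply le_add.
Qed.

Lemma mul_eq0 x y : x * y = 0 -> x = 0 \/ y = 0.
Proof.
  intro H. destruct (zero_or_succ y) as [->|[z ->]]; [now right|left].
  rewrite mul_S in H. now apply add_eq0 in H.
Qed.

Lemma mul_cancel x y z : x <> 0 -> x * y = x * z -> y = z.
Proof.
  intros Hx. revert y z.
  enough (forall y d, x * y = x * (y + d) -> y = y + d) as K.
  { intros y z H. destruct (add_or y z) as [[d ->]|[d ->]]; [symmetry|]; now apply K. }
  intros y d H. rewrite mulDr in H. rewrite <- (add_0 (x * y)) in H at 1.
  apply add_cancel in H. symmetry in H.
  apply mul_eq0 in H as [H| ->]; [tauto|]. now rewrite add_0.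
Qed.

Lemma le_mul x y : y <> 0 -> x <= x * y.
Proof.
  intro H. destruct (zero_or_succ y) as [->|[z ->]]; [tauto|].
  rewrite mul_S, addC. apply le_add.
Qed.

Lemma le_mul_mono x y z : x <= y -> x * z <= y * z.
Proof.
  rewrite !le_ex. intros [d ->]. exists (d * z). ring.
Qed.

Lemma le_add_mono x y z t : x <= y -> z <= t -> x + z <= y + t.
Proof.
  rewrite !le_ex. intros [d ->] [e ->]. exists (d + e). ring.
Qed.

Lemma lt_succ_self x : x < succ x.
Proof. apply lt_succ, le_refl. Qed.

Lemma two_le x : 2 <= x <-> x <> 0 /\ x <> 1.
Proof.
  split.
  - intro H. split; intros ->.
    + apply le_0_eq in H. exact (succ_neq0 H).
    + exact (lt_irrefl H).
  - intros [H0 H1]. destruct (le_or_lt 2 x) as [H|H]; [trivial|].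
    apply lt_2 in H. tauto.
Qed.

(** ** Decidable predicates *)

Definition dist x y : M := ev pdist (pair x y).

Lemma dist_eq0 x y : dist x y = 0 <-> x = y.
Proof.
  unfold dist, pdist. ev_simpl. fold (sub x y) (sub y x).
  change (x - y + (y - x) = 0 <-> x = y).
  rewrite add_eq0. split.
  - intros [H H']. now apply le_antisym.
  - intros ->. split; apply le_refl.
Qed.

Lemma not_eq0 f x : ev (pnot f) x = 0 <-> ev (m := M) f x <> 0.
Proof.
  unfold pnot, pone. ev_simpl. change (1 <= ev f x <-> ev f x <> 0).
  rewrite neq0_lt. reflexivity.
Qed.

Lemma not_neq0 f x : ev (m := M) f x <> 0 -> ev (pnot f) x = 0.
Proof. apply not_eq0. Qed.

Lemma not_of_0 f x : ev (m := M) f x = 0 -> ev (pnot f) x = 1.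
Proof. intro H. unfold pnot, pone. ev_simpl. rewrite H. apply sub_0. Qed.

(** Conjunction becomes a sum, and negation subtraction from [1]. *)
Lemma dec_char P : decidable (@fn M) P ->
  exists f, fn f /\ forall x, P x <-> f x = 0.
Proof.
  induction 1 as [f g Hf Hg|P Q _ (f & Hf & Ef) _ (g & Hg & Eg)
                 |P _ (f & Hf & Ef)|P Q _ (f & Hf & Ef) E].
  - exists (fun x => dist (f x) (g x)). split; [unfold dist; fn|].
    intro x. symmetry. apply dist_eq0.
  - exists (fun x => f x + g x). split; [fn|]. intro x. rewrite add_eq0. firstorder.
  - exists (fun x => 1 - f x). split; [fn|]. intro x. rewrite Ef, neq0_lt. reflexivity.
  - exists f. split; [trivial|]. intro x. now rewrite E.
Qed.

(** A bounded quantifier becomes a finite sum, which is defined by recursion. *)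
Lemma dec_ball (Q : M -> M -> Prop) u : fn u ->
  decidable (@fn M) (fun z => Q (ev PK z) (ev PL z)) ->
  decidable (@fn M) (fun x => forall y, y < u x -> Q x y).
Proof.
  intros Hu HQ. destruct (dec_char HQ) as (f & Hf & Ef).
  assert (E : forall x y, Q x y <-> f (pair x y) = 0).
  { intros x y. now rewrite <- Ef, ev_K, ev_L. }
  destruct (fn_rec (m := M) (f := fun _ => zero M) (g := fun z => ev PL z + f (ev PK z)))
    as (h & Hh & Eh); [fn|fn|].
  apply dec_iff with (fun x => h (pair x (u x)) = 0); [dec|].
  intro x. destruct (Eh x) as [E0 ES].
  assert (ES' : forall n, h (pair x (succ n)) = 0 <-> h (pair x n) = 0 /\ Q x n).
  { intro n. now rewrite ES, ev_L, ev_K, add_eq0, E. }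
  split.
  - intro H. enough (forall m, m <= u x -> h (pair x m) = 0) by (apply H0, le_refl).
    intro m. ind m; [trivial|]. intro Hm. apply ES'. split; [apply IH|apply H; trivial].
    exact (lt_le Hm).
  - intros H y. rewrite E. revert H. generalize (u x). intro n. ind n.
    + intros _ H. now apply lt_0 in H.
    + intros H Hy. apply ES' in H as [H H']. rewrite lt_succ in Hy.
      destruct (le_eq_or_lt Hy) as [->|Hy']; [now apply E|auto].
Qed.
End Arithmetic.

Ltac dec_ball_step := lazymatch goal with
  | |- decidable _ (fun x => forall y, lt y (@?u x) -> @?Q x y) =>
      apply (dec_ball (u := u) (Q := Q)); [fn|cbv beta; dec]
  end.
Ltac dec_ext ::= dec_ball_step.

(** * Divisibility, primes and the coding of sequences *)

Section Primes.
Variable M : model.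
Implicit Types (x y z n m d i j k q s t w : M) (P : M -> Prop).

Add Ring model_ring : (model_semiring M).

(** If no least element existed, induction on [n] would show that nothing below [n]
    satisfies [P]. *)
Lemma least P x : decidable (@fn M) P -> P x ->
  exists y, P y /\ forall z, z < y -> ~ P z.
Proof.
  intros HP Hx. apply NNPP. intro H.
  destruct (dec_char HP) as (f & Hf & Ef).
  enough (K : forall n z, z < n -> ~ f z = 0).
  { apply (K (succ x) x); [apply lt_succ_self|now apply Ef]. }
  intro n. ind n.
  - intros z Hz. now apply lt_0 in Hz.
  - intros z Hz Fz. apply lt_succ_le in Hz. apply H. exists z.
    split; [now apply Ef|]. intros u Hu. rewrite Ef. apply IH.
    exact (lt_le_trans Hu Hz).
Qed.

(** ** Bounded search *)

Lemma ite_0 c a b x : ev (m := M) c x = 0 -> ev (pite c a b) x = ev a x.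
Proof. intro H. unfold pite. ev_simpl. rewrite H, ev_rec0. now ev_simpl. Qed.

Lemma ite_n0 c a b x : ev (m := M) c x <> 0 -> ev (pite c a b) x = ev b x.
Proof.
  intro H. destruct (zero_or_succ (ev c x)) as [E|[y E]]; [tauto|].
  unfold pite, rx. ev_simpl. rewrite E, ev_recS. now ev_simpl.
Qed.

Lemma mu_spec f x n :
  ev (pmu f) (pair x n) <= n /\
  (ev (pmu f) (pair x n) < n -> ev f (pair x (ev (pmu f) (pair x n))) = 0) /\
  forall i, i < ev (pmu f) (pair x n) -> ev (m := M) f (pair x i) <> 0.
Proof.
  assert (E0 : ev (pmu f) (pair x 0) = (0 : M)).
  { unfold pmu. now rewrite ev_rec0, ev_Zero. }
  assert (ES : forall n, ev (m := M) f (pair x (ev (pmu f) (pair x n))) = 0 ->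
                 ev (pmu f) (pair x (succ n)) = ev (pmu f) (pair x n)).
  { intros k H. unfold pmu at 1. rewrite ev_recS. fold (pmu f).
    rewrite ite_0; unfold rr, rx; ev_simpl; trivial. }
  assert (ES' : forall n, ev (m := M) f (pair x (ev (pmu f) (pair x n))) <> 0 ->
                 ev (pmu f) (pair x (succ n)) = succ (ev (pmu f) (pair x n))).
  { intros k H. unfold pmu at 1. rewrite ev_recS. fold (pmu f).
    rewrite ite_n0; unfold rr, rx; ev_simpl; trivial. }
  ind n.
  - rewrite E0. split; [apply le_refl|]. split; intros; now destruct (lt_0 H).
  - destruct IH as (H1 & H2 & H3).
    destruct (classic (ev f (pair x (ev (pmu f) (pair x n))) = 0)) as [H|H].
    + rewrite (ES _ H). split; [|split]; auto. exact (le_trans H1 (le_succ n)).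
    + rewrite (ES' _ H). destruct (le_eq_or_lt H1) as [E|H']; [|tauto].
      split; [rewrite E; apply le_refl|split].
      * rewrite E. intro K. now destruct (lt_irrefl K).
      * intros i Hi. apply lt_succ_le in Hi.
        destruct (le_eq_or_lt Hi) as [->|Hi']; auto.
Qed.

Lemma mu_lt f x n :
  ev (pmu f) (pair x n) < n <-> exists i, i < n /\ ev (m := M) f (pair x i) = 0.
Proof.
  destruct (mu_spec f x n) as (H1 & H2 & H3). split.
  - intro H. exists (ev (pmu f) (pair x n)). auto.
  - intros (i & Hi & Fi). destruct (le_or_lt n (ev (pmu f) (pair x n))) as [H|H]; [|trivial].
    destruct (H3 i); [|trivial]. exact (lt_le_trans Hi H).
Qed.

(** ** Divisibility *)

Definition divides d n : Prop := exists q, n = d * q.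

Lemma pdvd_spec d n : ev pdvd (pair d n) = 0 <-> divides d n.
Proof.
  unfold pdvd. ev_simpl.
  match goal with |- context [ev (pmu ?f)] => set (g := f) end.
  change (ev (pmu g) (pair (pair d n) (succ n)) <= n <-> divides d n).
  assert (Eg : forall q, ev g (pair (pair d n) q) = 0 <-> n = d * q).
  { intro q. unfold g. ev_simpl. change (dist (d * q) n = 0 <-> n = d * q).
    rewrite dist_eq0. split; congruence. }
  rewrite <- lt_succ, mu_lt. split.
  - intros (i & _ & H). exists i. now apply Eg.
  - intros [q E]. destruct (zero_or_succ d) as [->|[d' Ed]].
    + exists 0. split; [apply lt_succ, le_0|]. apply Eg.
      now rewrite mul_0l in *.
    + exists q. split; [|now apply Eg]. apply lt_succ. rewrite E, mulC.
      apply le_mul. rewrite Ed. apply succ_neq0.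
Qed.

Lemma dec_divides (u v : M -> M) : fn u -> fn v ->
  decidable (@fn M) (fun x => divides (u x) (v x)).
Proof.
  intros Hu Hv. apply dec_iff with (fun x => ev pdvd (pair (u x) (v x)) = 0); [dec|].
  intro x. symmetry. apply pdvd_spec.
Qed.

Lemma divides_refl x : divides x x.
Proof. exists 1. ring. Qed.

Lemma divides_trans x y z : divides x y -> divides y z -> divides x z.
Proof. intros [q ->] [r ->]. exists (q * r). ring. Qed.

Lemma divides_mul x y z : divides x y -> divides x (y * z).
Proof. intros [q ->]. exists (q * z). ring. Qed.

Lemma divides_le x y : divides x y -> y <> 0 -> x <= y.
Proof. intros [q ->] H. apply le_mul. intros ->. apply H. apply mul_0. Qed.

Lemma divides_0 x : divides 0 x -> x = 0.
Proof. intros [q ->]. apply mul_0l. Qed.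

Lemma divides_1 x : divides x 1 -> x = 1.
Proof.
  intro H. destruct (le_eq_or_lt (divides_le H (@one_neq0 M))) as [E|E]; [trivial|].
  apply -> lt_1 in E. subst x. apply divides_0 in H. now destruct (@one_neq0 M).
Qed.

Lemma divides_succ x y : divides x y -> divides x (succ y) -> x = 1.
Proof.
  intros [q ->] [r E]. apply divides_1.
  destruct (add_or r q) as [[e ->]|[e ->]].
  - exists e. rewrite mulDr, succ_add in E. now apply add_cancel in E.
  - destruct (@lt_irrefl M (x * r)). rewrite <- E at 2.
    apply lt_succ. rewrite mulDr. apply le_add.
Qed.

(** ** Primes *)

Definition prime q : Prop := 2 <= q /\ forall i, divides i q -> i = 1 \/ i = q.

Lemma pprime_spec q : ev pprime q = 0 <-> prime q.
Proof.
  unfold pprime. ev_simpl.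
  match goal with |- context [ev (pmu ?f)] => set (g := f) end.
  assert (Eg : forall i, ev g (pair q i) = 0 <-> 2 <= i /\ divides i q).
  { intro i. unfold g, ptwo, pone. ev_simpl.
    change ((2 - i) + ev pdvd (pair i q) = 0 <-> 2 <= i /\ divides i q).
    rewrite add_eq0, pdvd_spec. reflexivity. }
  unfold ptwo, pone. ev_simpl.
  change ((2 - q) + (q - ev (pmu g) (pair q q)) = 0 <-> prime q).
  rewrite add_eq0. unfold prime.
  split.
  - intros [H2 H]. split; [exact H2|]. intros i Hi.
    apply two_le in H2 as [Hq0 Hq1].
    destruct (zero_or_succ i) as [->|[i' Ei]]; [now apply divides_0 in Hi|].
    destruct (classic (i = 1)) as [|Hi1]; [now left|right].
    assert (Hi2 : 2 <= i).
    { apply two_le. split; [|trivial]. rewrite Ei. apply succ_neq0. }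
    destruct (le_eq_or_lt (divides_le Hi Hq0)) as [|Hlt]; [trivial|].
    assert (K : ev (pmu g) (pair q q) < q).
    { apply mu_lt. exists i. split; [trivial|]. now apply Eg. }
    destruct (lt_not_le K H).
  - intros [H2 H]. split; [exact H2|].
    destruct (le_or_lt q (ev (pmu g) (pair q q))) as [K|K]; [exact K|].
    apply mu_lt in K as (i & Hi & K). apply Eg in K as [K1 K2].
    destruct (H i K2) as [->| ->].
    + now apply two_le in K1.
    + now apply lt_irrefl in Hi.
Qed.

Lemma prime_neq0 q : prime q -> q <> 0.
Proof. intros [H _]. now apply two_le in H. Qed.

Lemma exists_prime_divisor n : 2 <= n -> exists q, prime q /\ divides q n.
Proof.
  intro H.
  destruct (@least (fun d => 2 <= d /\ divides d n) n) as (q & [H2 Hq] & Hmin).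
  - apply (dec_and (P := fun d => 2 <= d)); [dec|apply dec_divides; fn].
  - split; [trivial|apply divides_refl].
  - exists q. split; [split|]; trivial. intros i Hi.
    apply two_le in H2 as [Hq0 _].
    destruct (classic (i = 1)) as [|Hi1]; [now left|right].
    assert (Hi2 : 2 <= i).
    { apply two_le. split; [|trivial]. intros ->. now apply divides_0 in Hi. }
    destruct (le_eq_or_lt (divides_le Hi Hq0)) as [|Hlt]; [trivial|].
    destruct (Hmin i Hlt). split; [trivial|]. exact (divides_trans Hi Hq).
Qed.

Lemma fact_0 : ev pfact (zero M) = 1.
Proof. unfold pfact, pnatrec, pone. ev_simpl. rewrite ev_rec0. now ev_simpl. Qed.

Lemma fact_S n : ev pfact (succ n) = succ n * ev pfact n.
Proof. unfold pfact, pnatrec, rn, rr. ev_simpl. rewrite ev_recS. now ev_simpl. Qed.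

Lemma fact_neq0 n : ev pfact n <> 0.
Proof.
  ind n; [rewrite fact_0; apply one_neq0|]. rewrite fact_S. intros [H|H]%mul_eq0.
  - exact (succ_neq0 H).
  - tauto.
Qed.

Lemma divides_fact i n : i <> 0 -> i <= n -> divides i (ev pfact n).
Proof.
  intro Hi. revert n.
  assert (K : forall n, i <= n -> ev pdvd (pair i (ev pfact n)) = 0).
  { intro n. ind n.
    - intros ->%le_0_eq. tauto.
    - intro H. apply pdvd_spec. rewrite fact_S.
      destruct (le_eq_or_lt H) as [->|H']; [apply divides_mul, divides_refl|].
      rewrite mulC. apply divides_mul, pdvd_spec, IH. now apply lt_succ. }
  intros n H. now apply pdvd_spec, K.
Qed.

(** Euclid: a prime divisor of [x! + 1] exceeds [x], and lies within the range of the
    search. *)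
Lemma nextprime_spec x : prime (ev pnextprime x) /\ x < ev pnextprime x.
Proof.
  unfold pnextprime. ev_simpl.
  match goal with |- context [ev (pmu ?f)] => set (g := f) end.
  assert (Eg : forall i, ev g (pair x i) = 0 <-> x < i /\ prime i).
  { intro i. unfold g. ev_simpl.
    change ((succ x - i) + ev pprime i = 0 <-> x < i /\ prime i).
    rewrite add_eq0, pprime_spec. reflexivity. }
  set (n := succ (succ (ev pfact x))).
  destruct (mu_spec g x n) as (_ & H & _). apply and_comm, Eg, H. clear H.
  apply mu_lt. destruct (@exists_prime_divisor (succ (ev pfact x))) as (q & Hq & Hd).
  - apply two_le. split; [apply succ_neq0|]. intro E. apply succ_inj in E.
    exact (fact_neq0 E).
  - exists q. split.
    + apply lt_succ. exact (divides_le Hd (@succ_neq0 M _)).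
    + apply Eg. split; [|trivial]. destruct (le_or_lt q x) as [H|H]; [|trivial].
      assert (E := divides_succ (divides_fact (prime_neq0 Hq) H) Hd).
      destruct Hq as [Hq _]. apply two_le in Hq. tauto.
Qed.

Definition nthprime n : M := ev pnthprime n.

Lemma nthprime_0 : nthprime 0 = 2.
Proof. unfold nthprime, pnthprime, pnatrec. ev_simpl. rewrite ev_rec0.
  unfold ptwo, pone. now ev_simpl. Qed.

Lemma nthprime_S n : nthprime (succ n) = ev pnextprime (nthprime n).
Proof.
  unfold nthprime, pnthprime, pnatrec, rr. ev_simpl. rewrite ev_recS. now ev_simpl.
Qed.

Lemma nthprime_prime n : prime (nthprime n).
Proof.
  apply pprime_spec. unfold nthprime. ind n; apply pprime_spec.
  - fold (nthprime 0). rewrite nthprime_0. split; [apply le_refl|].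
    intros i Hi. assert (H2 : (2 : M) <> 0) by apply succ_neq0.
    destruct (le_eq_or_lt (divides_le Hi H2)) as [|H]; [now right|left].
    apply lt_2 in H as [->|]; [|trivial]. now apply divides_0 in Hi.
  - fold (nthprime (succ n)). rewrite nthprime_S. apply nextprime_spec.
Qed.

Lemma nthprime_lt i j : i < j -> nthprime i < nthprime j.
Proof.
  unfold nthprime. ind j; [intro H; now apply lt_0 in H|].
  fold (nthprime (succ j)). rewrite nthprime_S. intros H%lt_succ_le.
  destruct (nextprime_spec (nthprime j)) as [_ K].
  destruct (le_eq_or_lt H) as [->|H']; [trivial|]. exact (lt_trans (IH H') K).
Qed.

Lemma lt_nthprime n : n < nthprime n.
Proof.
  unfold nthprime. ind n.
  - apply neq0_lt, prime_neq0, nthprime_prime.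
  - fold (nthprime (succ n)). rewrite nthprime_S.
    apply le_lt_trans with (nthprime n); [exact IH|]. apply nextprime_spec.
Qed.

Lemma nthprime_coprime i j : i <> j -> ~ divides (nthprime i) (nthprime j).
Proof.
  intros H Hd. apply (nthprime_prime j) in Hd as [E|E].
  - destruct (nthprime_prime i) as [K _]. apply two_le in K. tauto.
  - destruct (le_or_lt i j) as [K|K].
    + destruct (le_eq_or_lt K) as [|K']; [tauto|]. apply nthprime_lt in K'.
      rewrite E in K'. exact (lt_irrefl K').
    + apply nthprime_lt in K. rewrite E in K. exact (lt_irrefl K).
Qed.

Lemma division a b : b <> 0 -> exists q r, a = b * q + r /\ r < (b : M).
Proof.
  intro Hb. destruct (@least (fun q => a < b * succ q) a) as (q & Hq & Hmin).
  - dec.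
  - apply lt_le_trans with (succ a); [apply lt_succ_self|].
    rewrite mulC. now apply le_mul.
  - assert (H : b * q <= a).
    { destruct (zero_or_succ q) as [->|[q' ->]]; [rewrite mul_0; apply le_0|].
      destruct (le_or_lt (b * succ q') a) as [|H]; [trivial|].
      destruct (Hmin q'); [apply lt_succ_self|trivial]. }
    apply le_ex in H as [r ->]. exists q, r. split; [trivial|].
    rewrite mul_S in Hq. destruct (le_or_lt b r) as [H|H]; [|trivial].
    destruct (lt_not_le Hq). apply le_add_mono; [apply le_refl|trivial].
Qed.

(** The least [c <> 0] such that [q] divides [c * b] divides all such numbers, by
    division with remainder.  Since [q] and [a] are among them, [c] is [1]. *)
Lemma euclid q a b : prime q -> divides q (a * b) -> ~ divides q a -> divides q b.
Proof.
  intros Hq Hab Ha. assert (Hq0 := prime_neq0 Hq).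
  destruct (@least (fun x => x <> 0 /\ divides q (x * b)) q) as (c & [Hc0 Hc] & Hmin).
  - apply (dec_and (P := fun x => x <> 0)); [dec|apply dec_divides; fn].
  - split; [trivial|]. now exists b.
  - assert (K : forall x, divides q (x * b) -> divides c x).
    { intros x Hx. destruct (division x Hc0) as (k & r & E & Hr).
      exists k. destruct (classic (r = 0)) as [->|Hr0]; [now rewrite add_0 in E|].
      destruct (Hmin r Hr). split; [trivial|].
      destruct Hx as [u Hu], Hc as [v Hv].
      assert (F : q * u = q * (v * k) + r * b).
      { rewrite <- Hu, E. replace (q * (v * k)) with (q * v * k) by ring.
        rewrite <- Hv. ring. }
      destruct (add_or u (v * k)) as [[e ->]|[e He]].
      - exists e. rewrite mulDr in F. now apply add_cancel in F.
      - exists 0. rewrite He in F.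
        assert (G : q * u + 0 = q * u + (q * e + r * b)).
        { rewrite add_0. rewrite F at 1. ring. }
        apply add_cancel in G. symmetry in G. apply add_eq0 in G as [_ ->].
        symmetry. apply mul_0. }
    destruct Hq as [_ Hq]. destruct (Hq c) as [->| ->].
    + apply K. now exists b.
    + replace b with (1 * b) by ring. exact Hc.
    + destruct Ha. now apply K.
Qed.

Lemma prime_mul q a b : prime q -> ~ divides q a -> ~ divides q b -> ~ divides q (a * b).
Proof. intros Hq Ha Hb H. exact (Hb (euclid Hq H Ha)). Qed.

(** ** Exponents *)

Lemma pow_0 x : x ^ 0 = 1.
Proof. unfold pow, ppow, pone. rewrite ev_rec0. now ev_simpl. Qed.

Lemma pow_S x n : x ^ succ n = x ^ n * x.
Proof. unfold pow, ppow, rr, rx. rewrite ev_recS. now ev_simpl. Qed.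

Lemma pow_add x n m : x ^ (n + m) = x ^ n * x ^ m.
Proof.
  ind m; [rewrite add_0, pow_0; ring|]. rewrite add_S, !pow_S, IH. ring.
Qed.

Lemma pow_neq0 x n : x <> 0 -> x ^ n <> 0.
Proof.
  intro Hx. ind n; [rewrite pow_0; apply one_neq0|].
  rewrite pow_S. intros [H|H]%mul_eq0; tauto.
Qed.

Lemma lt_pow q n : 2 <= q -> n < q ^ n.
Proof.
  intro Hq. ind n; [rewrite pow_0; apply lt_succ_self|].
  rewrite pow_S. apply le_ex in Hq as [d ->]. apply lt_ex in IH as [e ->].
  apply lt_ex. exists (n + e + e + 1 * d + (n + e) * d).
  unfold two, one. rewrite !succ_add, !add_0l. ring.
Qed.

Lemma prime_pow q p n : prime q -> ~ divides q p -> ~ divides q (p ^ n).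
Proof.
  intros Hq Hp. assert (K : ev pdvd (pair q (p ^ n)) <> 0); [|now rewrite pdvd_spec in K].
  ind n; rewrite pdvd_spec in *.
  - rewrite pow_0. intros ->%divides_1. destruct Hq as [Hq _]. apply two_le in Hq. tauto.
  - rewrite pow_S. now apply prime_mul.
Qed.

Lemma val_spec q e m : 2 <= q -> ~ divides q m -> ev pval (pair q (q ^ e * m)) = e.
Proof.
  intros Hq Hm. set (n := q ^ e * m).
  assert (Hq0 : q <> 0) by (now apply two_le in Hq).
  assert (Hm0 : m <> 0) by (intros ->; apply Hm; exists 0; ring).
  assert (Hdiv : forall i, divides (q ^ succ i) n <-> i < e).
  { intro i. split.
    - intros [c Hc]. destruct (le_or_lt e i) as [H|H]; [|trivial].
      apply le_ex in H as [d ->]. destruct Hm. exists (q ^ d * c).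
      apply mul_cancel with (q ^ e); [now apply pow_neq0|]. fold n. rewrite Hc, pow_S, pow_add.
      ring.
    - intro H. apply le_ex in H as [d Hd]. exists (q ^ d * m). unfold n.
      rewrite Hd, pow_add. ring. }
  unfold pval. ev_simpl.
  match goal with |- context [ev (pmu ?f)] => set (g := f) end.
  assert (Eg : forall i, ev g (pair (pair q n) i) = 0 <-> ~ i < e).
  { intro i. unfold g. rewrite not_eq0. ev_simpl.
    change (ev pdvd (pair (q ^ succ i) n) <> 0 <-> ~ i < e).
    now rewrite pdvd_spec, Hdiv. }
  assert (Hen : e < n).
  { apply (lt_le_trans (lt_pow e Hq)). now apply le_mul. }
  destruct (mu_spec g (pair q n) n) as (_ & H2 & H3).
  assert (Hlt : ev (pmu g) (pair (pair q n) n) < n).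
  { apply mu_lt. exists e. split; [trivial|]. apply Eg, lt_irrefl. }
  apply Eg in H2; [|trivial].
  apply le_antisym.
  - destruct (le_or_lt (ev (pmu g) (pair (pair q n) n)) e) as [|H]; [trivial|].
    destruct (H3 e H). apply Eg, lt_irrefl.
  - destruct (le_or_lt e (ev (pmu g) (pair (pair q n) n))) as [|H]; tauto.
Qed.

(** ** Products of prime powers *)

Lemma not_divides_1 q : prime q -> ~ divides q 1.
Proof. intros [Hq _] ->%divides_1. apply two_le in Hq. tauto. Qed.

(** [h n] is the product of [nthprime i ^ a i] over all [i < n]. *)
Section Product.
Variables a h : M -> M.
Hypothesis Hh : fn h.
Hypothesis h_0 : h 0 = 1.
Hypothesis h_S : forall n, h (succ n) = h n * nthprime n ^ a n.

Lemma product_coprime j n : n <= j -> ~ divides (nthprime j) (h n).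
Proof.
  assert (Hj := nthprime_prime j). rewrite <- pdvd_spec. ind n; rewrite pdvd_spec in *.
  - intros _. rewrite h_0. now apply not_divides_1.
  - intro H. rewrite h_S. apply prime_mul; [trivial|apply IH, (lt_le H)|].
    apply prime_pow; [trivial|]. apply nthprime_coprime. intros ->. exact (lt_irrefl H).
Qed.

(** The conclusion is not decidable as it stands; induction proves that the [a i]-th
    power of the prime divides [h n] and the next power does not. *)
Lemma product_exponent i n : i < n ->
  exists m, h n = nthprime i ^ a i * m /\ ~ divides (nthprime i) m.
Proof.
  assert (Hi := nthprime_prime i). assert (Hi0 := prime_neq0 Hi).
  set (q := nthprime i) in *.
  assert (K : i < n -> divides (q ^ a i) (h n) /\ ~ divides (q ^ succ (a i)) (h n)).
  { rewrite <- !pdvd_spec. ind n; [intro H; now apply lt_0 in H|].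
    rewrite !pdvd_spec in *. intros H%lt_succ_le. rewrite h_S.
    destruct (le_eq_or_lt H) as [->|H'].
    - fold q. rewrite mulC. split; [apply divides_mul, divides_refl|].
      rewrite pow_S. intros [c E]. apply (@product_coprime n n); [apply le_refl|].
      exists c. apply mul_cancel with (q ^ a n); [now apply pow_neq0|].
      fold q. rewrite E. ring.
    - destruct (IH H') as [K1 K2]. split; [now apply divides_mul|].
      destruct K1 as [c Hc]. rewrite Hc in *. intros [d E].
      assert (Hd : divides q (c * nthprime n ^ a n)).
      { exists d. apply mul_cancel with (q ^ a i); [now apply pow_neq0|].
        rewrite pow_S in E. rewrite mulA, E. ring. }
      apply euclid in Hd; [|trivial|].
      + refine (prime_pow Hi _ Hd). apply nthprime_coprime. intros ->.
        exact (lt_irrefl H').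
      + intros [d' ->]. apply K2. exists d'. rewrite pow_S. ring. }
  intro H. destruct (K H) as [[m E] K2]. exists m. split; [trivial|].
  intros [c ->]. apply K2. exists c. rewrite E, pow_S. ring.
Qed.

End Product.

Lemma exists_product (a : M -> M) : fn a ->
  exists h, fn h /\ h 0 = 1 /\ forall n, h (succ n) = h n * nthprime n ^ a n.
Proof.
  intro Ha.
  destruct (fn_rec (m := M) (f := fun _ => 1)
    (g := fun z => ev PL z * nthprime (ev PL (ev PK z)) ^ a (ev PL (ev PK z))))
    as (h & Hh & Eh); [fn|unfold nthprime; fn|].
  exists (fun n => h (pair 0 n)). split; [fn|]. destruct (Eh 0) as [E0 ES].
  split; [trivial|]. intro n. rewrite ES. now rewrite !ev_L, !ev_K, ev_L.
Qed.

(** ** Codes of finite sequences *)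

Definition length s : M := ev plength s.
Definition entry s i : M := ev pentry (pair s i).

Lemma length_0 : length 0 = 0.
Proof.
  unfold length, plength. ev_simpl. unfold rx, rn.
  match goal with |- ev (PRec PZero (pite ?f ?b ?c)) _ = _ => set (g := f); set (u := b) end.
  enough (K : forall n, ev (PRec PZero (pite g u rr)) (pair 0 n) = (0 : M)) by apply K.
  intro n. ind n; [now rewrite ev_rec0, ev_Zero|].
  rewrite ev_recS, ite_n0; [unfold rr; now rewrite ev_L|].
  unfold g. ev_simpl. fold (nthprime n). change (succ 0) with (1 : M).
  rewrite pdvd_spec. apply not_divides_1, nthprime_prime.
Qed.

Lemma length_spec s k : divides (nthprime k) (succ s) ->
  (forall j, k < j -> ~ divides (nthprime j) (succ s)) -> length s = succ k.
Proof.
  intros Hk Hj. unfold length, plength. ev_simpl. unfold rx, rn.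
  match goal with |- ev (PRec PZero (pite ?f ?b ?c)) _ = _ => set (g := f); set (u := b) end.
  assert (Eg : forall n r, ev g (pair (pair s n) r) = 0 <-> divides (nthprime n) (succ s)).
  { intros n r. unfold g. ev_simpl. fold (nthprime n). apply pdvd_spec. }
  enough (K : forall n, k < n -> ev (PRec PZero (pite g u rr)) (pair s n) = succ k).
  { apply K. apply (lt_le_trans (lt_nthprime k)).
    apply divides_le; [trivial|apply succ_neq0]. }
  intro n. ind n; [intro H; now apply lt_0 in H|].
  intros H%lt_succ_le. rewrite ev_recS. destruct (le_eq_or_lt H) as [<-|H'].
  - rewrite ite_0; [unfold u; now ev_simpl|]. now apply Eg.
  - rewrite ite_n0; [unfold rr; rewrite ev_L; auto|]. rewrite Eg. auto.
Qed.

Lemma entry_eq s i : entry s i =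
  ev pval (pair (nthprime i) (succ s)) - ev (pnot (pdist ∘ ⟪PSucc ∘ PL, plength ∘ PK⟫)) (pair s i).
Proof. unfold entry, pentry. now ev_simpl. Qed.

(** Take the product of the prime powers with exponents [a i].  One more factor, the
    last prime, marks the length even if the last value is [0]; [entry] takes this
    factor away again. *)
Lemma exists_code (a : M -> M) : fn a ->
  forall n, exists s, length s = n /\ forall i, i < n -> entry s i = a i.
Proof.
  intros Ha n. destruct (exists_product Ha) as (h & Hh & h_0 & h_S).
  destruct (zero_or_succ n) as [->|[k ->]].
  { exists 0. split; [apply length_0|]. intros i H. now apply lt_0 in H. }
  assert (Hpk := nthprime_prime k).
  (* the last prime gets one more factor, and the code is smaller by one *)
  destruct (zero_or_succ (h (succ k) * nthprime k)) as [H0|[s Es]].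
  { exfalso. apply mul_eq0 in H0 as [H0|H0]; [|exact (prime_neq0 Hpk H0)].
    apply (product_coprime Hh h_0 h_S (j := succ k) (le_refl _)).
    rewrite H0. exists 0. ring. }
  assert (Hlen : length s = succ k).
  { apply length_spec; rewrite <- Es.
    - exists (h (succ k)). ring.
    - intros j Hj. apply prime_mul; [apply nthprime_prime|now apply product_coprime with a|].
      apply nthprime_coprime. intros ->. exact (lt_irrefl Hj). }
  exists s. split; [trivial|]. intros i Hi.
  assert (Hpi := nthprime_prime i).
  destruct (product_exponent Hh h_0 h_S Hi) as (m & Em & Hm).
  rewrite entry_eq, <- Es.
  apply lt_succ_le in Hi. destruct (le_eq_or_lt Hi) as [->|Hlt].
  - replace (h (succ k) * nthprime k) with (nthprime k ^ succ (a k) * m)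
      by (rewrite Em, pow_S; ring).
    rewrite val_spec; [|apply Hpk|trivial].
    rewrite not_of_0; [unfold one; rewrite sub_SS; apply sub_0|].
    ev_simpl. fold (length s). apply dist_eq0. congruence.
  - rewrite not_neq0.
    + rewrite sub_0, Em, <- mulA. apply val_spec; [apply Hpi|].
      apply prime_mul; trivial. apply nthprime_coprime. intros ->. exact (lt_irrefl Hlt).
    + ev_simpl. fold (length s). rewrite Hlen. intro H. apply dist_eq0, succ_inj in H.
      subst. exact (lt_irrefl Hlt).
Qed.

(** ** Words

    A number [w] is read as a binary sequence whose [i]-th bit tells whether the
    [i]-th prime divides [w].  Such words have no length and are not unique, but
    every binary sequence has a word below a bound that depends on the length
    only.  Quantification over the binary sequences of a given length is
    therefore bounded. *)

Definition bit w i : M := 1 - ev pdvd (pair (nthprime i) w).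

Lemma bit_1 w i : divides (nthprime i) w -> bit w i = 1.
Proof. intros H%pdvd_spec. unfold bit. rewrite H. apply sub_0. Qed.

Lemma bit_0 w i : ~ divides (nthprime i) w -> bit w i = 0.
Proof.
  intro H. rewrite <- pdvd_spec, neq0_lt in H. exact H.
Qed.

Definition pprimorial : pr := pnatrec pone (pmul ∘ ⟪rr, pnthprime ∘ rn⟫).
Definition primorial n : M := ev pprimorial n.

Lemma primorial_0 : primorial 0 = 1.
Proof. unfold primorial, pprimorial, pnatrec, pone. ev_simpl. rewrite ev_rec0. now ev_simpl. Qed.

Lemma primorial_S n : primorial (succ n) = primorial n * nthprime n.
Proof.
  unfold primorial, pprimorial, pnatrec, rr, rn. ev_simpl. rewrite ev_recS. now ev_simpl.
Qed.

Lemma product_bit (a h : M -> M) : fn h -> h 0 = 1 ->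
  (forall n, h (succ n) = h n * nthprime n ^ a n) -> (forall i, a i < 2) ->
  forall n i, i < n -> bit (h n) i = a i.
Proof.
  intros Hh h_0 h_S Hbin n i Hi.
  destruct (product_exponent Hh h_0 h_S Hi) as (m & Em & Hm). rewrite Em.
  assert (H := Hbin i). apply lt_2 in H as [E|E]; rewrite E.
  - apply bit_0. rewrite pow_0. now replace (1 * m) with m by ring.
  - apply bit_1. exists m. unfold one. rewrite pow_S, pow_0. ring.
Qed.

Lemma product_le_primorial (a h : M -> M) : fn h -> h 0 = 1 ->
  (forall n, h (succ n) = h n * nthprime n ^ a n) -> (forall i, a i < 2) ->
  forall n, h n <= primorial n.
Proof.
  intros Hh h_0 h_S Hbin n. unfold primorial. ind n.
  - fold (primorial 0). rewrite h_0, primorial_0. apply le_refl.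
  - fold (primorial (succ n)) (primorial n) in *.
    rewrite h_S, primorial_S. apply le_trans with (h n * nthprime n); [|now apply le_mul_mono].
    rewrite !(mulC (h n)). apply le_mul_mono.
    assert (H := Hbin n). apply lt_2 in H as [E|E]; rewrite E.
    + rewrite pow_0. apply neq0_lt, prime_neq0, nthprime_prime.
    + unfold one. rewrite pow_S, pow_0.
      replace (1 * nthprime n) with (nthprime n) by ring. apply le_refl.
Qed.

Lemma exists_word (a : M -> M) : fn a -> (forall i, a i < 2) ->
  forall n, exists w, w <= primorial n /\ forall i, i < n -> bit w i = a i.
Proof.
  intros Ha Hbin n. destruct (exists_product Ha) as (h & Hh & h_0 & h_S).
  exists (h n). split; [now apply product_le_primorial with a|].
  intros i Hi. now apply product_bit.
Qed.

End Primes.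

(** * Formulas read in the structure of a world *)

Section Reading.
Implicit Types (w v : world) (s t : nterm) (a b : fterm).

Definition val w t : model_of w := cls w t.
Definition fval w a : model_of w -> model_of w := app (w := w) a.

Lemma val_app w a t : val w (a @ t) = fval a (val w t).
Proof. exact (cls_app w a t). Qed.

Lemma val_const w (f : pr) t : val w (f @ t) = ev f (val w t).
Proof. exact (cls_app w f t). Qed.

Lemma val_pair w s t : val w ⟨s, t⟩ = pair (val w s) (val w t).
Proof. exact (cls_pair w s t). Qed.

Lemma val_zero w : val w NZero = 0.
Proof. reflexivity. Qed.

Lemma val_surj w (x : model_of w) : exists t, x = val w t.
Proof. exact (cls_surj x). Qed.

Lemma fn_fval w a : fn (fval (w := w) a).
Proof. now exists a. Qed.

Lemma w_eq w s t : w (s == t) <-> val w s = val w t.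
Proof. symmetry. apply cls_eq. Qed.

Lemma w_neq w s t : w (¬ s == t) <-> val w s <> val w t.
Proof.
  rewrite <- w_eq. split; [apply w_not|]. destruct (w_eq_dec w s t); tauto.
Qed.

End Reading.

Ltac vals := unfold Succ; repeat first
  [ rewrite val_const | rewrite val_app | rewrite val_pair | rewrite val_zero ].

Section Reading.
Implicit Types (w v : world) (s t : nterm) (a b : fterm).

Lemma w_lt w s t : w (Lt s t) <-> val w s < val w t.
Proof. unfold Lt. rewrite w_eq. vals. reflexivity. Qed.

(** A bounded universal statement with decidable matrix does not look at later
    worlds: by induction on the bound, it holds or the world contains a
    counterexample. *)
Lemma w_bounded_all w A n : dec_form w A ->
  (forall t, w (Lt t n) -> w (instN A t)) -> w (AllN (Lt #0 (nup n) ⇒ A)).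
Proof.
  intros HA H.
  pose (A' := subst (scons #0 (fun i => #(S (S i)))) FVar A).
  assert (EA : forall u t, subst (scons t (scons u NVar)) FVar A' = instN A t).
  { intros u t. unfold A', instN. rewrite subst_comp, scons_map. reflexivity. }
  pose (F := AllN (Lt #0 #1 ⇒ A')).
  pose (G := ExN (Lt #0 #1 ∧ ¬ A')).
  assert (HF : forall v u, stably v (fun v' => forall t, v' (Lt t u) -> v' (instN A t)) ->
            v (subst (scons u NVar) FVar F)).
  { intros v u Hv. apply w_all_imp. apply (stably_mono Hv). intros v' Hv' t.
    rewrite EA. apply Hv'. }
  assert (HF' : forall v u, v (subst (scons u NVar) FVar F) ->
            forall t, v (Lt t u) -> v (instN A t)).
  { intros v u Hv t Ht. rewrite <- (EA u). exact (w_mp (w_all Hv t) Ht). }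
  assert (HG : forall v u, v (subst (scons u NVar) FVar G) <->
            exists t, v (Lt t u) /\ v (¬ instN A t)).
  { intros v u. unfold G. rewrite w_ex.
    split; intros [t Ht]; exists t; revert Ht;
      change (subst (scons t (scons u NVar)) FVar (Lt #0 #1 ∧ ¬ A'))
        with (Lt t u ∧ ¬ subst (scons t (scons u NVar)) FVar A');
      now rewrite EA, w_and. }
  assert (K : w (subst NVar FVar (AllN (Or F G)))).
  { apply w_ind.
    - apply (w_or w). left. apply HF. apply stably_always. intros v t Ht.
      apply w_lt in Ht. now apply lt_0 in Ht.
    - apply (stably_mono (stably_stably HA)). intros v HAv u Hu.
      apply (w_or v). apply (w_or v) in Hu as [Hu|Hu].
      + destruct (stably_now HAv u) as [Hd|Hd].
        * left. apply HF.
          apply (stably_mono (stably_and (stably_thy Hu) (stably_thy Hd))).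
          intros v' [H1 H2] t Ht. apply w_lt in Ht. unfold Succ in Ht. rewrite val_const in Ht.
          apply lt_succ_le in Ht. destruct (le_eq_or_lt Ht) as [E|E].
          -- apply w_rewrite with u; [now apply w_eq|exact H2].
          -- apply (HF' _ _ H1). now apply w_lt.
        * right. apply HG. exists u. split; [|trivial]. apply w_lt. vals. apply lt_succ_self.
      + right. apply HG. apply HG in Hu as (t & Ht & Ht'). exists t. split; [|trivial].
        apply w_lt. apply w_lt in Ht. vals. exact (lt_trans Ht (@lt_succ_self _ _)). }
  assert (Kn := w_all K n). apply (w_or w) in Kn as [Kn|Kn].
  - replace (AllN (Lt #0 (nup n) ⇒ A)) with (subst (scons n NVar) FVar F); [exact Kn|].
    unfold F. cbn [subst]. f_equal. unfold A'.
    replace (subst _ _ (subst _ _ A)) with A; [reflexivity|].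
    rewrite subst_comp, scons_map. simpl. symmetry. etransitivity; [|apply subst_id].
    f_equal. apply (scons_eta NVar).
  - apply HG in Kn as (t & Ht & Ht'). destruct (w_not Ht'). auto.
Qed.

Lemma w_InitSeg w s a n : w (InitSeg s a n) <->
  length (val w s) = val w n /\
  forall x, x < val w n -> entry (val w s) x = fval a x.
Proof.
  assert (X : forall t, instN (Entry (nup s) #0 == a @ #0) t = (Entry s t == a @ t)).
  { intro t. unfold instN. simpl. rewrite nsubst_nup, nsubst_id, fsubst_id. reflexivity. }
  assert (Y : forall t, w (Entry s t == a @ t) <-> entry (val w s) (val w t) = fval a (val w t)).
  { intro t. rewrite w_eq. unfold Entry. vals. reflexivity. }
  unfold InitSeg. rewrite w_and, w_eq. unfold Length at 1. rewrite val_const.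
  apply and_iff_compat_l. split.
  - intros H x Hx. destruct (val_surj x) as [t ->]. apply Y. rewrite <- X.
    rewrite <- (subst_id (AllN _)) in H. refine (w_mp (w_all H t) _).
    apply w_lt in Hx. simpl. rewrite nsubst_nup, nsubst_id. exact Hx.
  - intro H. apply w_bounded_all.
    + apply stably_always. intros v t. rewrite X. apply w_eq_dec.
    + intros t Ht. rewrite X. apply Y. apply H. now apply w_lt.
Qed.

Lemma w_InCantor w a : w (InCantor a) -> forall x : model_of w, fval a x < 2.
Proof.
  intros H x. destruct (val_surj x) as [t ->].
  rewrite <- (subst_id (InCantor a)) in H. assert (K := w_all H t). simpl in K.
  rewrite fsubst_id in K. apply w_lt in K. unfold Two in K. revert K. vals. exact (fun H => H).
Qed.

Lemma w_InCantor_intro w a :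
  stably w (fun v => forall x : model_of v, fval a x < 2) -> w (InCantor a).
Proof.
  intro H. rewrite <- (subst_id (InCantor a)). apply w_all_intro.
  apply (stably_mono H). intros v Hv t. simpl. rewrite fsubst_id. apply w_lt.
  unfold Two. vals. apply Hv.
Qed.

Lemma BarCantor_body B r f a n s :
  subst (scons s (scons n r)) (scons a f)
    (subst (scons #0 (fun i => #(S (S i)))) (fun i => $(S i)) B)
  = subst (scons s r) f B.
Proof. rewrite subst_comp, scons_map. reflexivity. Qed.

Lemma w_Bar w r f B : w (subst r f (BarCantor B)) -> forall a, w (InCantor a) ->
  exists n s, w (InitSeg s a n) /\ w (subst (scons s r) f B).
Proof.
  intros H a Ha. assert (K := w_mp (w_allF H a) Ha).
  apply (w_ex w r (scons a f)) in K as [n K].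
  apply (w_ex w (scons n r) (scons a f)) in K as [s K].
  exists n, s. rewrite <- (BarCantor_body B r f a n s).
  apply (w_and w) in K. exact K.
Qed.

Lemma w_Bar_intro w r f B :
  stably w (fun v => forall a, v (InCantor a) ->
    exists n s, v (InitSeg s a n) /\ v (subst (scons s r) f B)) ->
  w (subst r f (BarCantor B)).
Proof.
  intro H. apply w_allF_imp. apply (stably_mono H). intros v Hv a Ha.
  destruct (Hv a Ha) as (n & s & H1 & H2).
  apply (w_ex v r (scons a f)). exists n.
  apply (w_ex v (scons n r) (scons a f)). exists s.
  apply (w_and v). split; [exact H1|]. now rewrite BarCantor_body.
Qed.

(** The premises and conclusions of the two principles, for a function [a] *)
Definition bar a : form := instF (BarCantor (InDf $0 #0)) a.
Definition finite_bar a t : form := subst (scons t NVar) (scons a FVar) BarInitSeg.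
Definition meets a : form := instF MeetsAllCantor a.
Definition both a : form := instF BothInE a.

Lemma w_bar w a : w (bar a) -> forall g, w (InCantor g) ->
  exists n s, w (InitSeg s g n) /\ fval a (val w s) <> 0.
Proof.
  intros H g Hg. destruct (w_Bar (r := NVar) (f := scons a FVar) (B := InDf $0 #0) H Hg)
    as (n & s & H1 & H2). exists n, s.
  split; [trivial|]. apply w_neq in H2. simpl in H2. now rewrite val_app in H2.
Qed.

Lemma w_bar_intro w a :
  stably w (fun v => forall g, v (InCantor g) ->
    exists n s, v (InitSeg s g n) /\ fval a (val v s) <> 0) ->
  w (bar a).
Proof.
  intro H. apply (w_Bar_intro (r := NVar) (f := scons a FVar) (B := InDf $0 #0)).
  apply (stably_mono H). intros v Hv g Hg.
  destruct (Hv g Hg) as (n & s & H1 & H2). exists n, s. split; [trivial|].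
  apply w_neq. simpl. now rewrite val_app.
Qed.

Lemma w_finite_bar w a t : w (finite_bar a t) <->
  exists c, w (InitSeg c a t) /\
    w (subst (scons c (scons t NVar)) (scons a FVar) (BarCantor (InDn #1 #0))).
Proof.
  unfold finite_bar, BarInitSeg. rewrite w_ex.
  split; intros [c Hc]; exists c; apply (w_and w); exact Hc || apply (w_and w) in Hc; exact Hc.
Qed.

Lemma w_InDn w c s : w (InDn c s) <->
  val w s < length (val w c) /\ entry (val w c) (val w s) <> 0.
Proof.
  unfold InDn. rewrite w_and, w_lt, w_neq. unfold Length, Entry. vals. reflexivity.
Qed.

Lemma w_InE w r f a t : w (subst r f (InE a t)) <->
  exists p, fval (fsubst f a) p = succ (val w (nsubst r f t)).
Proof.
  unfold InE. rewrite w_ex.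
  assert (X : forall p, w (subst (scons p r) f (a @ #0 == Succ (nup t))) <->
    fval (fsubst f a) (val w p) = succ (val w (nsubst r f t))).
  { intro p. simpl. rewrite w_eq, nsubst_nup. vals. reflexivity. }
  split; intros [p Hp].
  - exists (val w p). now apply X.
  - destruct (val_surj p) as [p' ->]. exists p'. now apply X.
Qed.

Lemma w_meets w a : w (meets a) -> forall g, w (InCantor g) ->
  exists n p, fval (w := w) a p = succ (pair n (fval g n)).
Proof.
  unfold meets, instF, MeetsAllCantor. intros H g Hg. assert (K := w_mp (w_allF H g) Hg).
  apply (w_ex w NVar (scons g (scons a FVar))) in K as [n K].
  apply w_InE in K as [p K]. exists (val w n), p. simpl in K.
  rewrite val_pair, val_app in K. exact K.
Qed.

Lemma w_meets_intro w a :
  stably w (fun v => forall g, v (InCantor g) ->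
    exists n p, fval (w := v) a p = succ (pair n (fval g n))) -> w (meets a).
Proof.
  unfold meets, instF, MeetsAllCantor.
  intro H. apply w_allF_imp. apply (stably_mono H). intros v Hv g Hg.
  destruct (Hv g Hg) as (n & p & E). destruct (val_surj n) as [n' ->].
  apply (w_ex v NVar (scons g (scons a FVar))). exists n'.
  apply w_InE. exists p. simpl. rewrite val_pair, val_app. exact E.
Qed.

(** From left to right the two instances of the bounded quantifier are [0] and [1]; from
    right to left, every [i < 2] of a later world equals one of them. *)
Lemma w_both w a : w (both a) <-> exists n,
  (exists p, fval (w := w) a p = succ (pair n 0)) /\
  (exists p, fval (w := w) a p = succ (pair n 1)).
Proof.
  set (r n := scons n NVar). set (f := scons a FVar).
  set (B := Lt #0 Two ⇒ InE $0 ⟨#1, #0⟩).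
  unfold both, instF, BothInE. rewrite w_ex. fold f B.
  assert (E : forall v n i, v (subst (scons i (r n)) f (InE $0 ⟨#1, #0⟩)) <->
            exists p, fval a p = succ (pair (val v n) (val v i))).
  { intros v n i. rewrite w_InE. simpl. now rewrite val_pair. }
  assert (E1 : val w (Succ NZero) = 1) by (now vals).
  split.
  - intros [n Hn].
    assert (K : forall i, val w i < 2 -> exists p, fval a p = succ (pair (val w n) (val w i))).
    { intros i Hi. apply E. apply (w_mp (w_all Hn i)). apply w_lt. unfold Two. now vals. }
    exists (val w n). split; [apply (K NZero)|rewrite <- E1; apply K]; apply lt_2;
      [now left|now right].
  - intros (n & H0 & H1). destruct (val_surj n) as [n' ->]. exists n'.
    apply w_all_imp.
    apply (E w n' NZero) in H0.
    rewrite <- E1 in H1. apply (E w n' (Succ NZero)) in H1.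
    apply (stably_mono (stably_and (stably_thy H0) (stably_thy H1))).
    intros v [K0 K1] i Hi. apply E in K0, K1. apply E.
    apply w_lt in Hi. simpl in Hi. unfold Two in Hi. unfold Succ in *. rewrite !val_const in *.
    apply lt_2 in Hi as [Hi|Hi]; rewrite Hi; [exact K0|exact K1].
Qed.

(** ** Functions that are defined in all later worlds *)

Lemma define w r f u : exists a, stably w (fun v => forall t,
  fval a (val v t) = val v (nsubst (scons t r) f u)).
Proof.
  destruct (comprehension w r f u) as [a Ha]. exists a. apply (stably_mono Ha).
  intros v Hv t. rewrite <- val_app. now apply w_eq.
Qed.

Lemma define_rec w a b : exists c, stably w (fun v => forall x : model_of v,
  fval c (pair x 0) = fval a x /\
  forall n, fval c (pair x (succ n)) = fval b (pair (pair x n) (fval c (pair x n)))).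
Proof.
  destruct (recursion w a b) as [c Hc]. exists c. apply (stably_mono Hc).
  intros v Hv x. destruct (val_surj x) as [t ->]. destruct (Hv t) as [H0 HS]. split.
  - apply w_eq in H0. revert H0. now vals.
  - intro n. destruct (val_surj n) as [m ->]. assert (K := HS m). apply w_eq in K.
    revert K. now vals.
Qed.

End Reading.

(** ** Bounded search *)

Section Search.
Variable M : model.

Lemma sum_search (f h : M -> M) : fn f -> fn h -> h 0 = 0 ->
  (forall n, h (succ n) = h n + (1 - f n)) ->
  forall n, h n <> 0 <-> exists p, p < n /\ f p = 0.
Proof.
  intros Hf Hh h_0 h_S n.
  assert (E : forall n, (h n = 0 -> forall p, p < n -> f p <> 0) /\
                        ((forall p, p < n -> f p <> 0) -> h n = 0)).
  { intro k. ind k.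
    - split; [|trivial]. intros _ p Hp. now apply lt_0 in Hp.
    - destruct IH as [IH1 IH2]. rewrite h_S, add_eq0.
      assert (K : 1 - f k = 0 <-> f k <> 0) by (now rewrite neq0_lt).
      split.
      + intros [H1 H2] p Hp%lt_succ_le. destruct (le_eq_or_lt Hp) as [->|Hp'].
        * now apply K.
        * now apply IH1.
      + intro H. split.
        * apply IH2. intros p Hp. apply H. exact (lt_trans Hp (@lt_succ_self _ _)).
        * apply K, H, lt_succ_self. }
  destruct (E n) as [E1 E2]. split.
  - intro H. apply NNPP. intro K. apply H, E2. intros p Hp F. apply K. now exists p.
  - intros (p & Hp & F) H. exact (E1 H p Hp F).
Qed.

Lemma one_sub_lt2 (x : M) : 1 - x < 2.
Proof.
  apply lt_2. destruct (zero_or_succ x) as [->|[y ->]]; [right; apply sub_0|left].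
  unfold one. rewrite sub_SS. apply sub_0l.
Qed.
End Search.

(** The function sought counts the zeros of [b]; a recursion suffices, and it keeps
    its meaning in all later worlds. *)
Lemma define_search w b : exists c, stably w (fun v => forall x n : model_of v,
  fval c (pair x n) <> 0 <-> exists p, p < n /\ fval b (pair x p) = 0).
Proof.
  destruct (define w NVar (scons b FVar)
    (padd @ ⟨PL @ #0, psub @ ⟨pone @ #0, $0 @ (PK @ #0)⟩⟩)) as [g Hg].
  destruct (define_rec w PZero g) as [c Hc]. exists c.
  apply (stably_mono (stably_and Hg Hc)). intros v [Hg' Hc'] x n.
  destruct (Hc' x) as [E0 ES].
  apply (sum_search (f := fun p => fval b (pair x p)) (h := fun n => fval c (pair x n))).
  - assert (H := fn_fval v b). fn.
  - assert (H := fn_fval v c). fn.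
  - rewrite E0. exact (ev_Zero (m := model_of v) x).
  - intro k. rewrite ES.
    destruct (val_surj (pair (pair x k) (fval c (pair x k)))) as [t Ht].
    rewrite Ht, Hg'. simpl. vals. rewrite <- Ht. unfold pone. ev_simpl. reflexivity.
Qed.

Lemma one_sub_eq0 (M : model) (x : M) : 1 - x = 0 <-> x <> 0.
Proof. rewrite neq0_lt. reflexivity. Qed.

Ltac compute_define H :=
  let x := fresh "x" in let t := fresh "t" in let E := fresh "E" in
  intro x; destruct (val_surj x) as [t E]; rewrite E, H; simpl; vals; rewrite <- E; reflexivity.

(** * From the fan theorem to the choice principle *)

Section Length.
Variable M : model.

Definition plength_bound : pr := pnatrec PZero (padd ∘ ⟪rr, plength ∘ rn⟫).

(** A finite set of sequence codes has bounded length; the sum of all lengths will do. *)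
Lemma length_bound (s m : M) : s < m -> length s <= ev plength_bound m.
Proof.
  assert (ES : forall n : M, ev plength_bound (succ n) = ev plength_bound n + length n).
  { intro n. unfold plength_bound, pnatrec, rr, rn. ev_simpl. rewrite ev_recS. now ev_simpl. }
  unfold length. ind m; [intro H; now apply lt_0 in H|].
  intros H%lt_succ_le. rewrite ES. destruct (le_eq_or_lt H) as [->|H'].
  - rewrite addC. apply le_add.
  - apply le_trans with (ev plength_bound m); [auto|apply le_add].
Qed.
End Length.

(** The decidable bar that belongs to an enumeration [a]: the sequences [s] for which
    one of the first [length s] values of [a] is a pair [(i, s(i))]. *)
Lemma define_hits w a : exists b, stably w (fun v => forall s,
  fval (w := v) b s <> 0 <-> exists p i,
    p < length s /\ i < length s /\ fval a p = succ (pair i (entry s i))).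
Proof.
  pose (y := ppred @ ($0 @ (PL @ #0))).
  destruct (define w NVar (scons a FVar)
    (padd @ ⟨psub @ ⟨pone @ #0, $0 @ (PL @ #0)⟩,
      padd @ ⟨psub @ ⟨Succ (PK @ y), Length (PK @ #0)⟩,
              pdist @ ⟨Entry (PK @ #0) (PK @ y), PL @ y⟩⟩⟩)) as [c Hc].
  destruct (define_search w c) as [d Hd].
  destruct (define w NVar (scons d FVar) ($0 @ ⟨#0, Length #0⟩)) as [b Hb].
  exists b. apply (stably_mono (stably_and (stably_and Hc Hd) Hb)).
  intros v [[Hc' Hd'] Hb'].
  assert (Ec : forall z, fval (w := v) c z =
    (1 - fval a (ev PL z)) +
    ((succ (ev PK (pred (fval a (ev PL z)))) - length (ev PK z)) +
     dist (entry (ev PK z) (ev PK (pred (fval a (ev PL z)))))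
          (ev PL (pred (fval a (ev PL z)))))).
  { intro z. destruct (val_surj z) as [t ->]. rewrite Hc'. unfold y, Length, Entry. simpl. vals.
    unfold pone. ev_simpl. reflexivity. }
  assert (Eb : forall s, fval (w := v) b s = fval d (pair s (length s))).
  { unfold Length in Hb'. compute_define Hb'. }
  intro s. rewrite Eb, Hd'. split.
  - intros (p & Hp & E). rewrite Ec, !ev_L, !ev_K, !add_eq0 in E.
    destruct E as (E1 & E2 & E3). apply -> one_sub_eq0 in E1. apply -> dist_eq0 in E3.
    destruct (zero_or_succ (fval a p)) as [E|[z E]]; [tauto|].
    rewrite E, pred_S in *. exists p, (ev PK z).
    split; [trivial|]. split; [exact E2|]. now rewrite E3, pair_KL.
  - intros (p & i & Hp & Hi & E). exists p. split; [trivial|].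
    rewrite Ec, !ev_L, !ev_K, E, pred_S, !ev_L, !ev_K, !add_eq0.
    split; [apply one_sub_eq0, succ_neq0|split; [exact Hi|now apply dist_eq0]].
Qed.

(** The sequence that avoids the set enumerated by the first [m] values of [a], as far
    as possible: it takes the value [0] at [i] unless [(i, 0)] has been enumerated. *)
Lemma define_left_choice w a m : exists g, stably w (fun v =>
  (forall x, fval (w := v) g x < 2) /\
  forall i, fval (w := v) g i <> 0 <-> exists p, p < val v m /\ fval a p = succ (pair i 0)).
Proof.
  destruct (define w NVar (scons a FVar)
    (pdist @ ⟨$0 @ (PL @ #0), Succ ⟨PK @ #0, NZero⟩⟩)) as [c Hc].
  destruct (define_search w c) as [d Hd].
  destruct (define w (scons m NVar) (scons d FVar)
    (psub @ ⟨pone @ #0, psub @ ⟨pone @ #0, $0 @ ⟨#0, #1⟩⟩⟩)) as [g Hg].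
  exists g. apply (stably_mono (stably_and (stably_and Hc Hd) Hg)).
  intros v [[Hc' Hd'] Hg'].
  assert (Ec : forall z, fval (w := v) c z =
            dist (fval a (ev PL z)) (succ (pair (ev PK z) 0))).
  { compute_define Hc'. }
  assert (Eg : forall i, fval (w := v) g i = 1 - (1 - fval d (pair i (val v m)))).
  { intro i. destruct (val_surj i) as [t ->]. rewrite Hg'. simpl. vals.
    unfold pone. ev_simpl. reflexivity. }
  split; [intro x; rewrite Eg; apply one_sub_lt2|].
  intro i. rewrite Eg, one_sub_eq0.
  assert (K : ~ ~ 1 - fval d (pair i (val v m)) = 0 <-> fval d (pair i (val v m)) <> 0).
  { rewrite one_sub_eq0. tauto. }
  rewrite K, Hd'. split; intros (p & Hp & E); exists p; (split; [trivial|]);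
    revert E; rewrite Ec, dist_eq0, ev_L, ev_K; trivial.
Qed.

(** If a finite part of the bar suffices, then [m] bounds the places in [a] that are
    relevant.  The sequence that avoids the pairs enumerated by then is still
    barred, say at [i]; its value there cannot be [0], hence it is [1], and so
    both [(i, 0)] and [(i, 1)] have been enumerated. *)
Lemma reduce_choice w a : exists b, stably w (fun v =>
  (v (meets a) -> v (bar b)) /\ ((exists m, v (finite_bar b m)) -> v (both a))).
Proof.
  destruct (define_hits w a) as [b Hb]. exists b.
  apply (stably_mono (stably_stably Hb)). intros v Hv. split.
  - intro Ha. apply w_bar_intro. apply (stably_mono (stably_and Hv (stably_thy Ha))).
    intros u [Hb' Ha'] g Hg. destruct (w_meets Ha' Hg) as (n & p & E).
    (* the initial part of [g] must be longer than both [n] and [p] *)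
    destruct (exists_code (fn_fval u g) (succ (n + p))) as (s & Hlen & Hs).
    destruct (val_surj (succ (n + p))) as [k Ek]. destruct (val_surj s) as [s' ->].
    assert (Hn : n < succ (n + p)) by apply lt_succ, le_add.
    exists k, s'. split.
    + apply w_InitSeg. rewrite <- Ek. auto.
    + apply Hb'. exists p, n. rewrite Hlen, Hs by trivial.
      split; [|split]; trivial. apply lt_succ. rewrite addC. apply le_add.
  - intros [m Hm]. apply w_finite_bar in Hm as (c & Hc & Hbar).
    apply w_InitSeg in Hc as [Hlen Hent].
    (* a sequence below [m] in the bar meets the set within this search bound *)
    destruct (define_left_choice v a (plength_bound @ m)) as [g Hg].
    assert (Hbin : v (InCantor g)).
    { apply w_InCantor_intro. apply (stably_mono Hg). now intros u [H _]. }
    apply stably_now in Hg as [_ Hg]. apply stably_now in Hv.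
    destruct (w_Bar Hbar Hbin) as (n & s & Hs & HD).
    change (v (InDn c s)) in HD. apply w_InDn in HD as [HD1 HD2].
    rewrite Hlen in HD1. rewrite Hent in HD2 by trivial.
    apply Hv in HD2 as (p & i & Hp & Hi & E).
    apply w_InitSeg in Hs as [Hs1 Hs2]. rewrite Hs1 in Hi.
    rewrite Hs2 in E by trivial.
    assert (Hp' : p < val v (plength_bound @ m)).
    { rewrite val_const. apply (lt_le_trans Hp). now apply length_bound. }
    assert (Hgi := w_InCantor Hbin i). apply lt_2 in Hgi as [G|G].
    + destruct (Hg i) as [_ K]. destruct K; [|trivial]. exists p. now rewrite <- G.
    + apply w_both. exists i. split.
      * destruct (Hg i) as [K _]. destruct K as (q & _ & Eq); [|now exists q].
        rewrite G. apply one_neq0.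
      * exists p. now rewrite <- G.
Qed.

(** * From the choice principle to the fan theorem *)

(** Bounded universal quantification: it fails iff the search for a failure stops
    before the bound. *)
Definition pball (f : pr) : pr := psub ∘ ⟪PL, pmu (pnot f)⟫.
Definition pbit : pr := pnot (pdvd ∘ ⟪pnthprime ∘ PL, PK⟫).

Section Secured.
Variable M : model.
Implicit Types (x k t e m n w c : M) (g a : M -> M).

Lemma pball_spec f x n :
  ev (pball f) (pair x n) = 0 <-> forall i, i < n -> ev f (pair x i) = 0.
Proof.
  unfold pball. ev_simpl. change (n <= ev (pmu (pnot f)) (pair x n) <->
    forall i, i < n -> ev f (pair x i) = 0).
  assert (K := mu_lt (pnot f) x n). split.
  - intros H i Hi. apply NNPP. intro Hf.
    apply (@lt_not_le M (ev (pmu (pnot f)) (pair x n)) n); [|trivial].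
    apply K. exists i. split; [trivial|]. now apply not_eq0.
  - intro H. destruct (le_or_lt n (ev (pmu (pnot f)) (pair x n))) as [|L]; [trivial|].
    apply K in L as (i & Hi & Hf). apply not_eq0 in Hf. destruct Hf. auto.
Qed.

Lemma pbit_eq w i : ev pbit (pair w i) = bit w i.
Proof. unfold pbit, pnot, pone. now ev_simpl. Qed.

Definition binary g : Prop := fn g /\ forall i, g i < 2.

Lemma bit_binary w : binary (bit w).
Proof.
  split; [|intro i; apply one_sub_lt2].
  unfold bit, nthprime. fn.
Qed.

(** By stage [m], the bar given by [a] is known to contain an initial part of [g]. *)
Definition hit a g m : Prop := exists c, c < m /\
  a c <> 0 /\ length c <= m /\ forall i, i < length c -> entry c i = g i.

(** The node of the binary tree that consists of the first [k] bits of the word [t]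
    and the bit [e] is secured at stage [m]: all paths through it have hit the
    bar.  As the paths are functions of the model, and not words, it is evident
    that nodes remain secured. *)
Definition secured a k t e m : Prop := forall g, binary g ->
  (forall i, i < k -> g i = bit t i) -> g k = e -> hit a g m.

Definition root_secured a m : Prop := secured a 0 0 0 m /\ secured a 0 0 1 m.

Lemma hit_mono a g m n : hit a g m -> m <= n -> hit a g n.
Proof.
  intros (c & Hc & Ha & Hlen & Hent) H. exists c.
  split; [exact (lt_le_trans Hc H)|]. split; [trivial|]. split; [exact (le_trans Hlen H)|].
  trivial.
Qed.

Lemma secured_mono a k t e m n : secured a k t e m -> m <= n -> secured a k t e n.
Proof. intros H Hmn g Hg H1 H2. apply hit_mono with m; auto. Qed.

Lemma hit_ext a g g' m n : (forall i, i < n -> g i = g' i) -> m <= n ->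
  hit a g m -> hit a g' m.
Proof.
  intros E Hmn (c & Hc & Ha & Hlen & Hent). exists c. repeat split; trivial.
  intros i Hi. rewrite Hent by trivial. apply E.
  exact (lt_le_trans (lt_le_trans Hi Hlen) Hmn).
Qed.

(** By stage [m] only the first [m] values of a path matter, besides the [k + 1] bits that
    are prescribed.  A word below the bound reproduces them. *)
Lemma secured_words a k t e m :
  secured a k t e m <->
  forall w, w < succ (primorial (m + succ k)) ->
    (forall i, i < k -> bit w i = bit t i) -> bit w k = e -> hit a (bit w) m.
Proof.
  split.
  - intros H w _. apply H, bit_binary.
  - intros H g [Hg Hbin] H1 H2. set (n := m + succ k) in *.
    destruct (exists_word Hg Hbin n) as (w & Hw & Ew).
    assert (Hk : k < n) by (unfold n, lt; rewrite addC; apply le_add).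
    apply (hit_ext (g := bit w) (n := n)); [trivial|apply le_add|]. apply H.
    + now apply lt_succ.
    + intros i Hi. rewrite Ew; [now apply H1|exact (lt_trans Hi Hk)].
    + now rewrite Ew.
Qed.

End Secured.

Definition pmatch : pr :=
  pball (pdist ∘ ⟪pentry ∘ ⟪PK ∘ PK, PL⟫, pbit ∘ ⟪PL ∘ PK, PL⟫⟫).
Definition pagree : pr :=
  pball (pdist ∘ ⟪pbit ∘ ⟪PK ∘ PK, PL⟫, pbit ∘ ⟪PL ∘ PK, PL⟫⟫).

Lemma pmatch_spec (M : model) (c w n : M) :
  ev pmatch (pair (pair c w) n) = 0 <-> forall i, i < n -> entry c i = bit w i.
Proof.
  unfold pmatch. rewrite pball_spec.
  split; intros H i Hi; specialize (H i Hi); revert H; ev_simpl; rewrite pbit_eq;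
    apply dist_eq0.
Qed.

Lemma pagree_spec (M : model) (w t n : M) :
  ev pagree (pair (pair w t) n) = 0 <-> forall i, i < n -> bit w i = bit t i.
Proof.
  unfold pagree. rewrite pball_spec.
  split; intros H i Hi; specialize (H i Hi); revert H; ev_simpl; rewrite !pbit_eq;
    apply dist_eq0.
Qed.

Lemma define_hit w a : exists h, stably w (fun v => forall x m,
  fval (w := v) h (pair x m) <> 0 <-> hit (fval a) (bit x) m).
Proof.
  destruct (define w NVar (scons a FVar)
    (padd @ ⟨psub @ ⟨pone @ #0, $0 @ (PL @ #0)⟩,
      padd @ ⟨psub @ ⟨plength @ (PL @ #0), PL @ (PK @ #0)⟩,
              pmatch @ ⟨⟨PL @ #0, PK @ (PK @ #0)⟩, plength @ (PL @ #0)⟩⟩⟩)) as [c Hc].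
  destruct (define_search w c) as [d Hd].
  destruct (define w NVar (scons d FVar) ($0 @ ⟨#0, PL @ #0⟩)) as [h Hh].
  exists h. apply (stably_mono (stably_and (stably_and Hc Hd) Hh)).
  intros v [[Hc' Hd'] Hh'] x m.
  assert (Ec : forall z, fval (w := v) c z =
    (1 - fval a (ev PL z)) +
    ((length (ev PL z) - ev PL (ev PK z)) +
     ev pmatch (pair (pair (ev PL z) (ev PK (ev PK z))) (length (ev PL z))))).
  { intro z. destruct (val_surj z) as [t ->]. rewrite Hc'. simpl. vals.
    unfold pone. ev_simpl. reflexivity. }
  assert (Eh : forall z, fval (w := v) h z = fval d (pair z (ev PL z))).
  { compute_define Hh'. }
  rewrite Eh, Hd', ev_L. unfold hit.
  split; intros (p & Hp & H); exists p; (split; [trivial|]); revert H;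
    rewrite Ec, !ev_L, !ev_K, !ev_L, !add_eq0, one_sub_eq0, pmatch_spec; trivial.
Qed.

Lemma define_secured w a : exists u, stably w (fun v => forall k t e m,
  fval (w := v) u (pair (pair (pair k t) e) m) = 0 <-> secured (fval a) k t e m).
Proof.
  destruct (define_hit w a) as [h Hh].
  pose (m := PL @ (PK @ #0)). pose (e := PL @ (PK @ (PK @ #0))).
  pose (k := PK @ (PK @ (PK @ (PK @ #0)))). pose (t := PL @ (PK @ (PK @ (PK @ #0)))).
  destruct (define w NVar (scons h FVar)
    (padd @ ⟨pagree @ ⟨⟨PL @ #0, t⟩, k⟩,
      padd @ ⟨pdist @ ⟨pbit @ ⟨PL @ #0, k⟩, e⟩, $0 @ ⟨PL @ #0, m⟩⟩⟩)) as [c Hc].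
  destruct (define_search w c) as [d Hd].
  destruct (define w NVar (scons d FVar)
    ($0 @ ⟨#0, Succ (pprimorial @ (padd @ ⟨PL @ #0, Succ (PK @ (PK @ (PK @ #0)))⟩))⟩))
    as [u Hu].
  exists u. apply (stably_mono (stably_and (stably_and Hh Hc) (stably_and Hd Hu))).
  intros v [[Hh' Hc'] [Hd' Hu']]. subst m e k t. clear Hh Hc Hd Hu. intros k t e m.
  assert (Ec : forall y, fval (w := v) c (pair (pair (pair (pair k t) e) m) y) =
    ev pagree (pair (pair y t) k) + (dist (bit y k) e + fval h (pair y m))).
  { intro y. destruct (val_surj (pair (pair (pair (pair k t) e) m) y)) as [z Ez].
    rewrite Ez, Hc'. simpl. vals. rewrite <- Ez. ev_simpl. rewrite pbit_eq.
    reflexivity. }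
  assert (Eu : fval (w := v) u (pair (pair (pair k t) e) m) =
    fval d (pair (pair (pair (pair k t) e) m) (succ (primorial (m + succ k))))).
  { destruct (val_surj (pair (pair (pair k t) e) m)) as [z Ez].
    rewrite Ez, Hu'. simpl. vals. rewrite <- Ez. ev_simpl. reflexivity. }
  rewrite secured_words, Eu.
  assert (K := Hd' (pair (pair (pair k t) e) m) (succ (primorial (m + succ k)))).
  split.
  - intros E y Hy H1 H2. apply Hh'. intro H. apply K; [|exact E].
    exists y. split; [trivial|]. rewrite Ec, !add_eq0, pagree_spec, dist_eq0. auto.
  - intro H. apply NNPP. intros N%K. destruct N as (y & Hy & E).
    rewrite Ec, !add_eq0, pagree_spec, dist_eq0 in E. destruct E as (E1 & E2 & E3).
    apply (Hh' y m); auto.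
Qed.

(** The set of pairs (node, bit) to which the choice principle is applied.  A pair is
    enumerated at stage [m] if the child of the node in this direction is secured
    and the other child is not.  Once the other child is secured too, this can no
    longer happen; so both directions are enumerated for the same node only
    because of the first clause, that is, if the root is secured. *)
Definition enumerated (M : model) (a : M -> M) (k t e m : M) : Prop :=
  root_secured a m \/ (secured a k t e m /\ ~ secured a k t (1 - e) m).

Lemma define_enumeration w a u :
  stably w (fun v => forall k t e m,
    fval (w := v) u (pair (pair (pair k t) e) m) = 0 <-> secured (fval a) k t e m) ->
  exists b, stably w (fun v => forall k t e m,
    (enumerated (fval (w := v) a) k t e m ->
     fval b (pair (pair (pair k t) e) m) = succ (pair (pair k t) e)) /\
    forall y, fval b (pair (pair (pair k t) e) m) = succ y ->
     y = pair (pair k t) e /\ enumerated (fval a) k t e m).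
Proof.
  intro Hu.
  (* [(K x + 1) * (1 - q)], where [q] is zero iff [x] is enumerated: it is the product of
     two sums, one for each clause of [enumerated] *)
  destruct (define w NVar (scons u FVar)
    (pmul @ ⟨Succ (PK @ #0), psub @ ⟨pone @ #0,
      pmul @ ⟨padd @ ⟨$0 @ ⟨⟨⟨NZero, NZero⟩, NZero⟩, PL @ #0⟩,
                      $0 @ ⟨⟨⟨NZero, NZero⟩, Succ NZero⟩, PL @ #0⟩⟩,
              padd @ ⟨$0 @ #0, psub @ ⟨pone @ #0,
                $0 @ ⟨⟨PK @ (PK @ #0), psub @ ⟨pone @ #0, PL @ (PK @ #0)⟩⟩, PL @ #0⟩⟩⟩⟩⟩⟩))
    as [b Hb].
  exists b. apply (stably_mono (stably_and Hu Hb)). clear Hu Hb.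
  intros v [Hu Hb] k t e m.
  set (x := pair (pair (pair k t) e) m).
  set (q := (fval u (pair (pair (pair 0 0) 0) m) + fval u (pair (pair (pair 0 0) 1) m)) *
    (fval (w := v) u x + (1 - fval u (pair (pair (pair k t) (1 - e)) m)))).
  assert (Eb : fval b x = succ (pair (pair k t) e) * (1 - q)).
  { destruct (val_surj x) as [z Ez]. rewrite Ez, Hb. simpl. vals. rewrite <- Ez.
    unfold q, pone, x. ev_simpl. reflexivity. }
  assert (Eq : q = 0 <-> enumerated (fval a) k t e m).
  { unfold enumerated, root_secured. rewrite <- !Hu. fold x.
    rewrite <- one_sub_eq0, <- !add_eq0. unfold q. split.
    - apply mul_eq0.
    - intros [E|E]; rewrite E; [apply mul_0l|apply mul_0]. }
  rewrite Eb. split.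
  - intros ->%Eq. rewrite sub_0. apply mul_1.
  - intros y E. destruct (zero_or_succ q) as [E0|[q' E0]]; rewrite E0 in E.
    + rewrite sub_0, mul_1 in E. split; [symmetry; now apply succ_inj|now apply Eq].
    + unfold one in E. rewrite sub_SS, sub_0l, mul_0 in E. symmetry in E.
      now apply succ_neq0 in E.
Qed.

(** The path [d] in the binary tree; [h k] is the word of its first [k] bits. *)
Section Path.
Variables (M : model) (a d h : M -> M).
Hypothesis binary_d : binary d.
Hypothesis fn_h : fn h.
Hypothesis h_0 : h 0 = 1.
Hypothesis h_S : forall n, h (succ n) = h n * nthprime n ^ d n.

Lemma path_bit k i : i < k -> bit (h k) i = d i.
Proof. destruct binary_d. now apply product_bit. Qed.

Lemma secured_path n m : hit a d m -> m <= n ->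
  forall e, secured a n (h n) e m.
Proof.
  intros Hd Hmn e g _ Hg _. apply (hit_ext (g := d) (n := n)); trivial.
  intros i Hi. rewrite Hg by trivial. symmetry. now apply path_bit.
Qed.

Lemma secured_prefix k m :
  (forall e, e < 2 -> secured a (succ k) (h (succ k)) e m) ->
  secured a k (h k) (d k) m.
Proof.
  intros H g Hg Hk E. apply (H (g (succ k))); trivial; [apply Hg|].
  intros i Hi. rewrite path_bit by trivial. apply lt_succ_le in Hi.
  destruct (le_eq_or_lt Hi) as [->|Hi']; [trivial|].
  rewrite Hk by trivial. now apply path_bit.
Qed.

(** Along the path [d], which is hit at stage [m], take the shortest initial part
    [k] that is secured at stage [m].  If [k] is not the root, its sibling is
    not secured, since otherwise the predecessor of [k] would be. *)
Lemma path_enumerated n m : hit a d m -> m <= n ->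
  (forall e, decidable (@fn M) (fun k => secured a k (h k) e m)) ->
  exists k, enumerated a k (h k) (d k) m.
Proof.
  intros Hd Hmn Hdec.
  destruct (@least M (fun k => secured a k (h k) 0 m /\ secured a k (h k) 1 m) n)
    as (k & [K0 K1] & Hmin).
  - now apply (dec_and (P := fun k => secured a k (h k) 0 m)).
  - split; apply (secured_path Hd Hmn).
  - destruct (zero_or_succ k) as [->|[k' ->]].
    + exists 0. left. split; intros g Hg _ E; [apply K0|apply K1]; trivial;
        intros i Hi; now apply lt_0 in Hi.
    + exists k'. right.
      assert (S : secured a k' (h k') (d k') m).
      { apply secured_prefix. intros e He. now apply lt_2 in He as [->| ->]. }
      split; [trivial|]. intro S'. apply (Hmin k'); [apply lt_succ_self|].
      assert (He := proj2 binary_d k'). apply lt_2 in He as [E|E]; rewrite E in S, S';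
        [rewrite sub_0 in S'|unfold one in S' at 1 2; rewrite sub_SS, sub_0l in S']; tauto.
Qed.

End Path.

Lemma both_enumerated (M : model) (a : M -> M) k t m n :
  enumerated a k t 0 m -> enumerated a k t 1 n -> exists l, root_secured a l.
Proof.
  intros [R|[S0 N1]]; [now exists m|]. intros [R|[S1 N0]]; [now exists n|].
  exfalso. rewrite sub_0 in N1. unfold one in N0. rewrite sub_SS, sub_0l in N0.
  destruct (le_or_lt m n) as [L|L].
  - apply N0. exact (secured_mono S0 L).
  - apply N1. exact (secured_mono S1 (lt_le L)).
Qed.

(** The path through the tree that a choice function [g] on the nodes describes: at each
    node it goes in the direction that [g] prescribes there. *)
Lemma define_path w g : exists d h, stably w (fun v =>
  (forall k, fval (w := v) d k = fval g (pair k (fval h k))) /\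
  fval (w := v) h 0 = 1 /\
  forall k, fval (w := v) h (succ k) = fval h k * nthprime k ^ fval d k).
Proof.
  destruct (define w NVar (scons g FVar)
    (pmul @ ⟨PL @ #0, ppow @ ⟨pnthprime @ (PL @ (PK @ #0)),
                              $0 @ ⟨PL @ (PK @ #0), PL @ #0⟩⟩⟩)) as [b Hb].
  destruct (define_rec w pone b) as [c Hc].
  destruct (define w NVar (scons c FVar) ($0 @ ⟨NZero, #0⟩)) as [h Hh].
  destruct (define w NVar (scons g (scons h FVar)) ($0 @ ⟨#0, $1 @ #0⟩)) as [d Hd].
  exists d, h.
  apply (stably_mono (stably_and (stably_and Hb Hc) (stably_and Hh Hd))).
  clear Hb Hc Hh Hd. intros v [[Hb Hc] [Hh Hd]].
  assert (Eb : forall z, fval (w := v) b z = ev PL z *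
    nthprime (ev PL (ev PK z)) ^ fval g (pair (ev PL (ev PK z)) (ev PL z))).
  { compute_define Hb. }
  assert (Eh : forall k, fval (w := v) h k = fval c (pair 0 k)).
  { compute_define Hh. }
  assert (Ed : forall k, fval (w := v) d k = fval g (pair k (fval h k))).
  { compute_define Hd. }
  destruct (Hc 0) as [E0 ES]. split; [trivial|]. split.
  - rewrite Eh, E0. change (ev pone 0 = (1 : model_of v)). unfold pone. now ev_simpl.
  - intro k. rewrite Eh, ES, Eb, Ed, !Eh. ev_simpl. reflexivity.
Qed.

(** A hit at stage [m] is an initial part with a code below [m], so the values of [a]
    below [m] already show that it is in the bar. *)
Lemma root_secured_finite_bar w a m :
  stably w (fun v => root_secured (fval (w := v) a) (val v m)) -> w (finite_bar a m).
Proof.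
  intro HR. destruct (exists_code (fn_fval w a) (val w m)) as (c & Hlen & Hent).
  destruct (val_surj c) as [c' ->].
  assert (Hc : w (InitSeg c' a m)) by (now apply w_InitSeg).
  apply w_finite_bar. exists c'. split; [trivial|].
  apply w_Bar_intro. apply (stably_mono (stably_and HR (stably_thy Hc))).
  intros v [[R0 R1] Hc'] g Hg.
  assert (Hbin : binary (fval (w := v) g)).
  { split; [apply fn_fval|now apply w_InCantor]. }
  assert (H : hit (fval a) (fval (w := v) g) (val v m)).
  { assert (N : forall t i : model_of v, i < 0 -> fval g i = bit t i)
      by (intros t i Hi; now apply lt_0 in Hi).
    assert (H0 := w_InCantor Hg 0). apply lt_2 in H0 as [E|E]; [apply R0|apply R1]; auto. }
  destruct H as (s & Hs & Ha & Hle & Hg'). destruct (val_surj s) as [s' ->].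
  exists (Length s'), s'. split.
  - apply w_InitSeg. unfold Length. rewrite val_const. auto.
  - change (v (InDn c' s')). apply w_InDn. apply w_InitSeg in Hc' as [Hlen' Hent'].
    rewrite Hlen'. split; [trivial|]. now rewrite Hent'.
Qed.

(** A choice function [g] gives a path; the bar contains an initial part of it, and
    [path_enumerated] finds a node at which the value of [g] is enumerated.
    Conversely, if both values are enumerated at some node, the root is secured. *)
Lemma reduce_fan w a : exists b, stably w (fun v =>
  (v (bar a) -> v (meets b)) /\ (v (both b) -> exists m, v (finite_bar a m))).
Proof.
  destruct (define_secured w a) as [u Hu].
  destruct (define_enumeration Hu) as [b Hb]. exists b.
  apply (stably_mono (stably_stably (stably_and Hu Hb))). clear Hu Hb.
  intros v Hv. split.
  - intro Ha. apply w_meets_intro.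
    apply (stably_mono (stably_stably (stably_and Hv (stably_thy Ha)))).
    intros z Hz g Hg. destruct (define_path z g) as (d & h & Hdh).
    assert (Hd : z (InCantor d)).
    { apply w_InCantor_intro. apply (stably_mono (stably_and Hdh (stably_thy Hg))).
      intros z' [[Ed _] Hg'] x. rewrite Ed. now apply w_InCantor. }
    apply stably_now in Hdh as (Ed & Eh0 & EhS). apply stably_now in Hz as [[Hu Hb] Ha'].
    assert (Hbin : binary (fval (w := z) d)).
    { split; [apply fn_fval|now apply w_InCantor]. }
    destruct (w_bar Ha' Hd) as (n & s & Hs & Has). apply w_InitSeg in Hs as [Hlen Hent].
    (* a stage above the code [s] and not below its length [n] *)
    set (m := succ (val z s) + val z n).
    assert (Hhit : hit (fval a) (fval (w := z) d) m).
    { exists (val z s). split; [apply le_add|]. split; [trivial|].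
      rewrite Hlen. split; [|trivial]. unfold m. rewrite addC. apply le_add. }
    destruct (path_enumerated Hbin (fn_fval z h) Eh0 EhS Hhit (le_refl m)) as [k Hk].
    { intro e. assert (K := fn_fval z h). assert (K' := fn_fval z u).
      apply dec_iff with
        (fun k => fval (w := z) u (pair (pair (pair k (fval h k)) e) m) = 0);
        [|intro k; symmetry; apply Hu].
      apply (dec_eq (f := fun k => fval u (pair (pair (pair k (fval h k)) e) m)) (g := fun _ => 0)).
      - apply (fn_comp (f := fval u)); [trivial|].
        repeat (apply fn_pair || apply fn_const || apply fn_id || trivial).
      - apply fn_const. }
    exists (pair k (fval h k)), (pair (pair (pair k (fval h k)) (fval d k)) m).
    rewrite <- Ed. now apply Hb.
  - intro Hboth. apply w_both in Hboth as (n & (p0 & E0) & (p1 & E1)).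
    assert (Hv' := stably_now Hv). destruct Hv' as [Hu Hb].
    assert (K : forall p e, fval b p = succ (pair n e) ->
      enumerated (fval (w := v) a) (ev PK n) (ev PL n) e (ev PL p)).
    { intros p e E.
      assert (Ep : p = pair (pair (pair (ev PK (ev PK (ev PK p))) (ev PL (ev PK (ev PK p))))
                              (ev PL (ev PK p))) (ev PL p)) by (now rewrite !pair_KL).
      rewrite Ep in E. apply Hb in E as [E H]. rewrite !pair_KL in E.
      rewrite <- E in H. now rewrite ev_K, ev_L in H. }
    destruct (both_enumerated (K _ _ E0) (K _ _ E1)) as [l [R0 R1]].
    destruct (val_surj l) as [m ->]. exists m. apply root_secured_finite_bar.
    (* that the root is secured is expressed by equations, which persist in later worlds *)
    pose (x e := ⟨⟨⟨NZero, NZero⟩, e⟩, m⟩).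
    assert (Ex : forall (z : world) e,
      val z (x e) = pair (pair (pair 0 0) (val z e)) (val z m)).
    { intros z e. unfold x. now vals. }
    assert (V1 : forall z, val z (Succ NZero) = 1) by (intro z; now vals).
    assert (S0 : v (u @ x NZero == NZero)).
    { apply w_eq. rewrite val_app, Ex. now apply Hu. }
    assert (S1 : v (u @ x (Succ NZero) == NZero)).
    { apply w_eq. rewrite val_app, Ex, V1. now apply Hu. }
    apply (stably_mono (stably_and Hv (stably_and (stably_thy S0) (stably_thy S1)))).
    intros z [[Hz _] [Z0 Z1]]. apply w_eq in Z0, Z1. rewrite val_app, Ex in Z0, Z1.
    rewrite V1 in Z1. split; now apply Hz.
Qed.

(** * The equivalences *)

(** A reduction of the premise [Q a] to [P b], and of the conclusion [R b] to [S a],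
    carries the principle for [P] and [R] over to [Q] and [S].  The same [b] takes
    counterexamples in the opposite direction. *)
Lemma transfer (P R Q S : form) :
  (forall w a, exists b, stably w (fun v =>
    (v (instF Q a) -> v (instF P b)) /\ (v (instF R b) -> v (instF S a)))) ->
  forall w : world,
  w (AllF (P ⇒ R) ⇒ AllF (Q ⇒ S)) /\ w (ExF (Q ∧ ¬ S) ⇒ ExF (P ∧ ¬ R)).
Proof.
  intros H w. split; apply w_imp, stably_always; intros v Hv.
  - rewrite <- (subst_id (AllF (Q ⇒ S))). apply w_allF_imp.
    apply (stably_mono (stably_thy Hv)). intros z Hz a Ha.
    destruct (H z a) as [b Hb]. apply stably_now in Hb as [H1 H2].
    apply H2. rewrite <- (subst_id (AllF _)) in Hz. exact (w_mp (w_allF Hz b) (H1 Ha)).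
  - rewrite <- (subst_id (ExF (Q ∧ ¬ S))) in Hv. rewrite <- (subst_id (ExF (P ∧ ¬ R))).
    apply (w_exF v NVar FVar) in Hv as [a Ha].
    apply (w_and v) in Ha as [Ha Hn]. destruct (H v a) as [b Hb].
    apply (w_exF v NVar FVar). exists b. apply (w_and v). split.
    + now apply (stably_now Hb).
    + apply (w_not_intro (w := v)). apply (stably_mono (stably_and Hb (stably_thy Hn))).
      intros z [[_ H2] H3] H4. exact (w_not H3 (H2 H4)).
Qed.

Lemma w_all_not (w : world) r f A :
  w (subst r f (AllN (¬ A))) <-> w (¬ subst r f (ExN A)).
Proof.
  split; intro H.
  - apply w_not_intro. apply (stably_mono (stably_thy H)). intros v Hv He.
    apply w_ex in He as [t Ht]. exact (w_not (w_all Hv t) Ht).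
  - apply w_all_imp. apply (stably_mono (stably_thy H)). intros v Hv t Ht.
    destruct (w_not Hv). apply w_ex. now exists t.
Qed.

Lemma strongNegFT_iff (w : world) :
  w strongNegFT <-> w (ExF (BarCantor (InDf $0 #0) ∧ ¬ ExN BarInitSeg)).
Proof.
  unfold strongNegFT. rewrite <- (subst_id (ExF _)), <- (subst_id (ExF (_ ∧ ¬ _))).
  rewrite !w_exF. split; intros [a Ha]; exists a; apply (w_and w); apply (w_and w) in Ha;
    split; try apply Ha; now apply w_all_not.
Qed.

Theorem theorem5p4 :
  BIM_proves (Iff FT Sigma01_AC2_contra) /\
  BIM_proves (Iff strongNegFT strongNegSigma01_AC2_contra).
Proof.
  assert (ex_fb : forall (w : world) a, w (instF (ExN BarInitSeg) a) <->
            exists m, w (finite_bar a m)) by (intros; apply w_ex).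
  assert (A : forall w : world, w (FT ⇒ Sigma01_AC2_contra) /\
    w (strongNegSigma01_AC2_contra ⇒ ExF (BarCantor (InDf $0 #0) ∧ ¬ ExN BarInitSeg))).
  { apply transfer. intros w a. destruct (reduce_choice w a) as [b Hb]. exists b.
    apply (stably_mono Hb). intros v [H1 H2]. split; [exact H1|]. rewrite ex_fb. exact H2. }
  assert (B : forall w : world, w (Sigma01_AC2_contra ⇒ FT) /\
    w (ExF (BarCantor (InDf $0 #0) ∧ ¬ ExN BarInitSeg) ⇒ strongNegSigma01_AC2_contra)).
  { apply transfer. intros w a. destruct (reduce_fan w a) as [b Hb]. exists b.
    apply (stably_mono Hb). intros v [H1 H2]. split; [exact H1|]. rewrite ex_fb. exact H2. }
  split; apply valid_proves; intro w; apply w_and; split.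
  - apply A.
  - apply B.
  - apply w_imp, stably_always. intros v H. apply strongNegFT_iff in H.
    exact (w_mp (proj2 (B v)) H).
  - apply w_imp, stably_always. intros v H. apply strongNegFT_iff.
    exact (w_mp (proj2 (A v)) H).
Qed.
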